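(* For the detection of a stationary scalar Gauss-Markov signal with correlation coefficient $a$ ($0\le a\le 1$) in i.i.d. Gaussian noise of variance $\sigma^2$ at signal-to-noise ratio (SNR) $\Gamma=\Pi_0/\sigma^2$, let $K$ be the error exponent of the miss probability of the fixed-level Neyman-Pearson detector. The error exponent $K$ is a continuous function of the correlation coefficient $a$ ($0\le a\le 1$) for a given SNR $\Gamma\ge0$. The error exponent as a function of correlation strength is characterized by the following: (i) For SNR $\Gamma\ge1$, $K$ is monotonically decreasing as the correlation strength increases (i.e. $a\uparrow1$); (ii) For SNR $\Gamma<1$, there exists a non-zero value $a^*$ of the correlation coefficient that achieves the maximal $K$, and $a^*$ is given by the solution of the following equation: $$[1+a^2+\Gamma(1-a^2)]^2-2\left(r_e+\frac{a^4}{r_e}\right)=0,$$ where $r_e=R_e/\sigma^2$. Furthermore, $a^*$ converges to one as $\Gamma$ goes to zero.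
   Context: Model: $H_0:\ y_i=w_i$ versus $H_1:\ y_i=s_i+w_i$, $i=1,\dots,n$, with $\{w_i\}$ i.i.d. $\mathcal N(0,\sigma^2)$ with known variance $\sigma^2$; $s_{i+1}=as_i+u_i$, $s_1\sim\mathcal N(0,\Pi_0)$, $u_i$ i.i.d. $\mathcal N(0,Q)$, $Q=\Pi_0(1-a^2)$, where $a$ and $\Pi_0$ are known scalars with $0\le a\le1$, $\Pi_0\ge0$; the process noise $\{u_i\}$ is independent of the measurement noise $\{w_i\}$, and the initial state $s_1$ is independent of all $u_i$. The SNR is $\Gamma=\Pi_0/\sigma^2$. For a fixed level $\alpha\in(0,1)$ (false-alarm probability $P_F\le\alpha$), the error exponent of the miss probability $P_M$ of the Neyman-Pearson detector is $K=\lim_{n\to\infty}-\frac1n\log P_M$. It does not depend on $\alpha$ and is given by $$K=\frac12\log\frac{R_e}{\sigma^2}+\frac12\frac{\tilde R_e}{R_e}-\frac12,\quad R_e=P+\sigma^2,\quad \tilde R_e=\sigma^2\left(1+\frac{a^2P^2}{P^2+2\sigma^2P+(1-a^2)\sigma^4}\right),$$ $$P=\frac12\sqrt{[\sigma^2(1-a^2)-Q]^2+4\sigma^2Q}-\frac12\sigma^2(1-a^2)+\frac Q2,$$ with $P=0$, $\tilde R_e=R_e=\sigma^2$ and $K=0$ at $a=1$. Here $R_e$ and $\tilde R_e$ are the steady-state variances of the innovations process of $\{y_i\}$ (one-step prediction errors of the minimum mean square error predictor designed for $H_1$) calculated under $H_1$ and $H_0$, respectively; $R_e$, and hence $r_e$,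 depends on $a$. *)

(* Defs.v *)
From HB Require Import structures.
From mathcomp Require Import all_boot all_order all_algebra.
From mathcomp Require Import all_classical all_reals all_analysis.

Set Implicit Arguments.
Unset Strict Implicit.
Unset Printing Implicit Defensive.

Import Order.TTheory GRing.Theory Num.Theory.
Import numFieldNormedType.Exports.

Local Open Scope classical_set_scope.
Local Open Scope ring_scope.

(* The centred Gaussian law of variance [v].  The second parameter of
   [normal_prob] is the standard deviation, and [normal_prob 0 0] is the uniform
   law on [0, 1], not the point mass: the degenerate case, which does occur here
   (Q = 0 when a = 1, Pi_0 = 0 when the SNR is 0), is therefore separate. *)
Definition gauss_law (R : realType) (v : R) : set R -> \bar R :=
  if v == 0 then \d_(0 : R) else normal_prob 0 (Num.sqrt v).

Definition has_gauss_law (R : realType) (d : measure_display)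
    (T : measurableType d) (P : probability T R) (X : T -> R) (v : R) : Prop :=
  forall A : set R, measurable A -> P (X @^-1` A) = gauss_law v A.

Definition mutually_independent (R : realType) (d : measure_display)
    (T : measurableType d) (P : probability T R) (I : eqType)
    (X : I -> T -> R) : Prop :=
  forall (J : seq I) (A : I -> set R), uniq J ->
    (forall i, measurable (A i)) ->
    P (\bigcap_(i in [set` J]) (X i @^-1` A i)) =
      (\prod_(i <- J) P (X i @^-1` A i))%E.

(* The random sources of the model.  Time is counted from 0: [gm_u S i] and
   [gm_w S i] are u_{i+1} and w_{i+1}. *)
Record gm_system (R : realType) := GMSystem {
  gm_disp : measure_display;
  gm_T : measurableType gm_disp;
  gm_P : probability gm_T R;
  gm_s1 : {RV gm_P >-> R};
  gm_u : nat -> {RV gm_P >-> R};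
  gm_w : nat -> {RV gm_P >-> R} }.

Definition gm_sources (R : realType) (S : gm_system R)
    (k : option (nat + nat)) : gm_T S -> R :=
  match k with
  | None => gm_s1 S
  | Some (inl i) => gm_u S i
  | Some (inr i) => gm_w S i
  end.

Definition gm_model (R : realType) (sigma2 Pi0 a : R) (S : gm_system R)
    : Prop :=
  [/\ has_gauss_law (gm_P S) (gm_s1 S) Pi0,
      forall i, has_gauss_law (gm_P S) (gm_u S i) (Pi0 * (1 - a ^+ 2)),
      forall i, has_gauss_law (gm_P S) (gm_w S i) sigma2 &
      mutually_independent (gm_P S) (@gm_sources R S)].

Fixpoint gm_signal (R : realType) (a : R) (S : gm_system R) (i : nat)
    (t : gm_T S) : R :=
  match i with
  | 0%N => gm_s1 S t
  | j.+1 => a * gm_signal a j t + gm_u S j t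
  end.

Definition obs_H0 (R : realType) (S : gm_system R) (n : nat) (t : gm_T S)
    : n.-tuple R := [tuple gm_w S i t | i < n].

Definition obs_H1 (R : realType) (a : R) (S : gm_system R) (n : nat)
    (t : gm_T S) : n.-tuple R :=
  [tuple gm_signal a i t + gm_w S i t | i < n].

(* A detector from n observations is a measurable region [D] of R^n on which
   H1 is decided. *)
Definition false_alarm (R : realType) (S : gm_system R) (n : nat)
    (D : set (n.-tuple R)) : \bar R := gm_P S (@obs_H0 R S n @^-1` D).

Definition miss (R : realType) (a : R) (S : gm_system R) (n : nat)
    (D : set (n.-tuple R)) : \bar R := gm_P S (@obs_H1 R a S n @^-1` ~` D).

(* Miss probability of the level-alpha Neyman-Pearson detector: the least miss
   probability under the constraint P_F <= alpha. *)
Definition NP_miss (R : realType) (a : R) (S : gm_system R) (alpha : R)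
    (n : nat) : R :=
  fine (ereal_inf [set miss a S D | D in
    [set D : set (n.-tuple R) |
       measurable D /\ (false_alarm S D <= alpha%:E)%E]]).

Definition error_exponent (R : realType) (a : R) (S : gm_system R) (alpha : R)
    : R :=
  limn (fun n : nat => - (n%:R^-1 * ln (NP_miss a S alpha n))).

(* Steady-state prediction error variance of the signal under H1. *)
Definition pred_var (R : realType) (sigma2 Pi0 a : R) : R :=
  let Q := Pi0 * (1 - a ^+ 2) in
  2^-1 * Num.sqrt ((sigma2 * (1 - a ^+ 2) - Q) ^+ 2 + 4 * sigma2 * Q)
  - 2^-1 * (sigma2 * (1 - a ^+ 2)) + Q / 2.

(* Steady-state variance of the innovations under H1. *)
Definition innov_var (R : realType) (sigma2 Pi0 a : R) : R :=
  pred_var sigma2 Pi0 a + sigma2.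

Definition astar_equation (R : realType) (sigma2 Gamma a : R) : Prop :=
  let re := innov_var sigma2 (Gamma * sigma2) a / sigma2 in
  (1 + a ^+ 2 + Gamma * (1 - a ^+ 2)) ^+ 2 - 2 * (re + a ^+ 4 / re) = 0.

Definition maximizes (R : realType) (f : R -> R) (a : R) : Prop :=
  0 <= a <= 1 /\ forall b, 0 <= b <= 1 -> f b <= f a.

(* Main.v *)
(* By Stein's lemma the miss exponent is the limit in probability, under the
   noise hypothesis, of - 1/n times the log-likelihood ratio of the signal
   hypothesis.  Conditionally on the signal at time k, the likelihood ratio of
   the later observations is the exponential of a quadratic polynomial in that
   signal; integrating the process noise and shifting the measurement noise one
   time step at a time, backwards, gives a Riccati recursion for its quadratic
   coefficient and a first-order linear recursion, driven by the observations,
   for its linear one.  Under the noise hypothesis the log-likelihood ratio is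
   then a martingale plus a linear term, up to errors bounded in L^1, and second
   moments suffice to find its limit.

   Put r = R_e / sigma^2 = 1 + y.  The limit depends on a only through r, namely
   K = (ln r - Gamma (r - 1) / (Gamma (r + 1) - (r - 1))) / 2, where y decreases
   strictly from Gamma to 0 as a goes from 0 to 1.  The sign of dK/dy is that of a
   quadratic polynomial in y, positive on [0, Gamma) when Gamma >= 1 and with
   exactly one root there when Gamma < 1; the left-hand side of the equation for
   a* is this polynomial up to a positive factor. *)
Require Import Defs.
From HB Require Import structures.
From mathcomp Require Import all_boot all_order all_algebra.
From mathcomp Require Import all_classical all_reals all_analysis.
From mathcomp Require Import measurable_realfun normal_distribution random_variable.
From mathcomp Require Import ring lra.

Import Order.TTheory GRing.Theory Num.Theory.
Import numFieldNormedType.Exports.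

Local Open Scope classical_set_scope.
Local Open Scope ring_scope.

Set Implicit Arguments.
Unset Strict Implicit.
Unset Printing Implicit Defensive.

(** * Gaussian expectations *)

(** No joint density of the observations is written down. Only the shift of the measurement noise
    divides by a variance, and [sigma2] is positive; integrating out the signal also makes sense for
    a point mass, so a vanishing [Q] or [Pi0] needs no change of measure of its own. Independence
    enters through one device: a single source is replaced by a copy on the second factor of
    [P \x P], and two expectations are compared with all other sources frozen.

    Because the recursions run backwards, the coefficients that multiply a noise depend on later
    noises only, hence are independent of it: this is what makes the increments orthogonal.

    Every deviation bound has the form C + eps n with eps arbitrary, which is all that Markov's
    inequality needs. The resulting probability is only compared with alpha and 1 - alpha, so the
    limit is the same for all levels.

    The stationary regime of the Riccati recursion is used for [Q] positive. If [Q = 0], what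
    remains of the log-likelihood ratio grows at most like ln n and the exponent is 0.

    In the analysis of K, the quadratic equation for y is linear in 1 - a^2; solving it for 1 - a^2
    instead of y removes the square roots. *)

Section density.
Local Open Scope ereal_scope.
Context d (T : measurableType d) (R : realType).
Import HBNNSimple.

(** Simple functions first, then monotone convergence under both measures. Here [m] will be the law
    of a Gaussian variable, which the model describes only by its values on measurable sets. *)
Lemma ge0_integral_density (mu m : {measure set T -> \bar R}) (h : T -> R) :
  measurable_fun setT h -> (forall x, (0 <= h x)%R) ->
  (forall A, measurable A -> m A = \int[mu]_(x in A) (h x)%:E) ->
  forall f : T -> \bar R, measurable_fun setT f -> (forall x, 0 <= f x) ->
  \int[m]_x f x = \int[mu]_x (f x * (h x)%:E).
Proof.
move=> mh h0 mE f mf f0.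
pose f_ := nnsfun_approx measurableT mf.
have Hn (g : {nnsfun T >-> R}) :
    \int[m]_x (g x)%:E = \int[mu]_x ((g x)%:E * (h x)%:E).
  under [LHS]eq_integral do rewrite fimfunE -fsumEFin//.
  rewrite [LHS]ge0_integral_fsum//; last 2 first.
  - by move=> r; exact/measurable_EFinP/measurableT_comp.
  - by move=> n x _; rewrite EFinM nnfun_muleindic_ge0.
  under [RHS]eq_integral.
    move=> x xD; rewrite fimfunE -fsumEFin// ge0_mule_fsuml; last first.
      by move=> r; rewrite EFinM nnfun_muleindic_ge0.
    over.
  rewrite [RHS]ge0_integral_fsum//; last 2 first.
  - move=> r; apply: emeasurable_funM; last exact/measurable_EFinP.
    by apply/measurable_EFinP; apply/measurableT_comp.
  - move=> n x _; apply: mule_ge0; last by rewrite lee_fin.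
    by rewrite EFinM nnfun_muleindic_ge0.
  apply: eq_fsbigr => r _.
  rewrite integralZl_indic_nnsfun//= integral_indic//= setIT.
  have mA : measurable (g @^-1` [set r]) by [].
  have [r0|r0] := leP 0%R r; last first.
    have -> : g @^-1` [set r] = set0.
      by apply/seteqP; split=> // x /= gx; have : (0 <= g x)%R by []; rewrite gx leNgt r0.
    rewrite measure0 mule0; apply/esym; apply: integral0_eq => x _.
    by rewrite indicE in_set0 mulr0 mul0e.
  rewrite mE// integral_mkcond/= -ge0_integralZl//; last 2 first.
  - exact/(measurable_restrictT _ _).1/measurable_funTS/measurable_EFinP.
  - by move=> x _; rewrite patchE; case: ifPn => // _; rewrite lee_fin.
  apply: eq_integral => x _; rewrite patchE indicE; case: ifPn => _.
    by rewrite mulr1.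
  by rewrite mulr0 mule0 mul0e.
transitivity (limn (fun n => \int[m]_x (f_ n x)%:E)).
  rewrite -monotone_convergence//=.
  - apply: eq_integral => ? /[!inE] xD; apply/esym/cvg_lim => //=.
    exact: cvg_nnsfun_approx.
  - by move=> n; exact/measurable_EFinP/measurable_funTS.
  - by move=> n ? _; rewrite lee_fin.
  - by move=> ? _ ? ? mn; rewrite lee_fin; exact/lefP/nd_nnsfun_approx.
under eq_fun do rewrite Hn.
rewrite -monotone_convergence//=.
- apply: eq_integral => x _; apply/cvg_lim => //=.
  by apply: cvgeZr => //; exact: cvg_nnsfun_approx.
- by move=> n; apply: emeasurable_funM; exact/measurable_EFinP.
- by move=> n x _; rewrite mule_ge0// lee_fin.
- move=> x _ a b ab; rewrite lee_wpmul2r ?lee_fin//.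
  exact/lefP/nd_nnsfun_approx.
Qed.

End density.

Section lebesgue_affine.
Local Open Scope ereal_scope.
Context (R : realType).
Notation mu := (@lebesgue_measure R).

Lemma ge0_integral_lebesgueN (f : R -> \bar R) :
  measurable_fun setT f -> (forall x, 0 <= f x) ->
  \int[mu]_x f (- x)%R = \int[mu]_x f x.
Proof.
move=> mf f0.
transitivity (\int[pushforward mu (-%R : _ -> measurableTypeR R)]_x f x).
  by rewrite ge0_integral_pushforward//= ?preimage_setT.
by apply: eq_measure_integral => A mA _; exact: lebesgue_measureN.
Qed.

Let shift_fun (c x : measurableTypeR R) : measurableTypeR R := (c + x)%R.

Let measurable_shift c : measurable_fun setT (shift_fun c).
Proof. exact: measurable_funD. Qed.

HB.instance Definition _ c :=
  isMeasurableFun.Build _ _ _ _ (shift_fun c) (measurable_shift c).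

Lemma lebesgue_measureD (c : R) (A : set R) : measurable A ->
  pushforward mu (shift_fun c) A = mu A.
Proof.
move=> mA; apply/esym.
apply: (@lebesgue_measure_unique R (pushforward mu (shift_fun c))) => //= _ [[a b]] _ <-.
rewrite /pushforward /=.
have -> : shift_fun c @^-1` `]a, b] = `](a - c)%R, (b - c)%R]%classic.
  by apply/seteqP; split=> x /=; rewrite !in_itv/= /shift_fun ltrBlDl lerBrDl.
rewrite !lebesgue_measure_itv/= !lte_fin ltrD2r.
by case: ifP => // _; rewrite -!EFinD; congr (_%:E); ring.
Qed.

Lemma ge0_integral_lebesgueD (c : R) (f : R -> \bar R) :
  measurable_fun setT f -> (forall x, 0 <= f x) ->
  \int[mu]_x f (c + x)%R = \int[mu]_x f x.
Proof.
move=> mf f0.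
transitivity (\int[pushforward mu (shift_fun c)]_x f x).
  by rewrite ge0_integral_pushforward//= ?preimage_setT//; exact: measurable_shift.
by apply: eq_measure_integral => A mA _; exact: lebesgue_measureD.
Qed.

End lebesgue_affine.

(** A Gaussian prior of variance v multiplied by the exponential of a quadratic is again Gaussian,
    of variance v / (1 + p v). The free [L] will be ln (1 + p v): it turns the ratio of the two
    normalising constants into an exponential. *)
Lemma gauss_complete_square (F : realFieldType) (p q c v x L : F) :
  v != 0 -> 1 + p * v != 0 ->
  - (p * (c + x) ^+ 2) / 2 + q * (c + x) + - x ^+ 2 / (v *+ 2) =
  L / 2 + (- (p / (1 + p * v) * c ^+ 2) / 2 + q / (1 + p * v) * c
     + (v / (1 + p * v) * q ^+ 2 - L) / 2
     + - (x - (q - p * c) * (v / (1 + p * v))) ^+ 2 / (v / (1 + p * v) *+ 2)).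
Proof. by move=> v0 D0; field; rewrite v0 D0. Qed.

Lemma integral_probability_cst (R : realType) d (T : measurableType d)
  (P : probability T R) (c : \bar R) : (\int[P]_t c = c)%E.
Proof.
rewrite [LHS](integral_cst P measurableT c).
by have /= -> := @probability_setT _ _ _ P; rewrite mule1.
Qed.

Lemma ler_addMgt0 (F : realFieldType) (x y C : F) :
  (forall p, 0 < p -> p <= 1 -> x <= y + p * C) -> x <= y.
Proof.
move=> h; rewrite leNgt; apply/negP => yx.
pose K := (x - y) + `|C| + 1.
have C0 := normr_ge0 C; have CC := ler_norm C.
have K0 : 0 < K by rewrite /K; lra.
have p0 : 0 < (x - y) / (2 * K) by rewrite divr_gt0 ?mulr_gt0// subr_gt0.
have p1 : (x - y) / (2 * K) <= 1.
  by rewrite ler_pdivrMr ?mulr_gt0// mul1r /K; lra.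
have := h _ p0 p1.
suff : (x - y) / (2 * K) * C < x - y by lra.
rewrite mulrAC ltr_pdivrMr ?mulr_gt0// ltr_pM2l ?subr_gt0// /K; lra.
Qed.

Section gauss_expectation.
Local Open Scope ereal_scope.
Context (R : realType) d (T : measurableType d) (P : probability T R)
  (X : {RV P >-> R}) (v : R).
Hypothesis hX : has_gauss_law P X v.
Notation mu := (@lebesgue_measure R).

Lemma gauss_expectation_dirac (f : R -> \bar R) : v = 0%R ->
  measurable_fun setT f -> (forall x, 0 <= f x) ->
  \int[P]_t f (X t) = f 0%R.
Proof.
move=> v0 mf f0; rewrite -(ge0_integral_distribution X mf)//.
rewrite (eq_measure_integral (\d_(0%R : R))); last first.
  by move=> A mA _; have := hX mA; rewrite /gauss_law v0 eqxx.
by rewrite integral_dirac// diracT mul1e.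
Qed.

Lemma gauss_expectation_density (f : R -> \bar R) : (0 < v)%R ->
  measurable_fun setT f -> (forall x, 0 <= f x) ->
  \int[P]_t f (X t) = \int[mu]_x (f x * (normal_pdf 0 (Num.sqrt v) x)%:E).
Proof.
move=> v0 mf f0.
pose X' : T -> measurableTypeR R := X.
have mX' : measurable_fun setT X' by exact: (measurable_funPT X).
pose XX : {RV P >-> measurableTypeR R} :=
  HB.pack X' (isMeasurableFun.Build _ _ _ _ _ mX').
have mf' : measurable_fun setT (f : measurableTypeR R -> \bar R) by exact: mf.
transitivity (\int[P]_t (f \o XX) t) => //.
rewrite -(ge0_integral_distribution XX mf')//.
apply: (@ge0_integral_density _ _ R mu (distribution P XX) (normal_pdf 0 (Num.sqrt v))) => //.
- exact: measurable_normal_pdf.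
- by move=> x; exact: normal_pdf_ge0.
- by move=> A mA; have := hX mA; rewrite /gauss_law gt_eqF.
Qed.

Lemma normal_pdf_sqrtE (m w x : R) : (0 < w)%R ->
  normal_pdf m (Num.sqrt w) x =
  ((Num.sqrt (w * pi *+ 2))^-1 * expR (- (x - m) ^+ 2 / (w *+ 2)))%R.
Proof.
move=> w0; rewrite normal_pdfE ?gt_eqF ?sqrtr_gt0//.
by rewrite /normal_peak /normal_fun sqr_sqrtr ?ltW.
Qed.

(** The one-dimensional Cameron-Martin formula, by translation invariance of Lebesgue measure. It
    trades a signal value added to a measurement noise for a likelihood factor. *)
Lemma gauss_shift (s : R) (f : R -> \bar R) : (0 < v)%R ->
  measurable_fun setT f -> (forall x, 0 <= f x) ->
  \int[P]_t f (s + X t)%R =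
  \int[P]_t (f (X t) * (expR ((s * X t - s ^+ 2 / 2) / v))%:E).
Proof.
move=> v0 mf f0.
have mfs : measurable_fun setT (fun x : R => f (s + x)%R).
  by apply: measurableT_comp => //; exact: measurable_funD.
rewrite (gauss_expectation_density (f := fun x => f (s + x)%R))//.
have me : measurable_fun setT (fun x : R => (expR ((s * x - s ^+ 2 / 2) / v))%:E).
  apply/measurable_EFinP; apply: measurableT_comp => //.
  apply: measurable_funM => //.
  by apply: measurable_funB; [exact: measurable_funM | exact: measurable_cst].
rewrite (gauss_expectation_density
  (f := fun x => f x * (expR ((s * x - s ^+ 2 / 2) / v))%:E))//; last 2 first.
- exact: emeasurable_funM.
- by move=> x; rewrite mule_ge0// lee_fin expR_ge0.
rewrite -[RHS](ge0_integral_lebesgueD s); last 2 first.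
- apply: emeasurable_funM; first exact: emeasurable_funM.
  by apply/measurable_EFinP; exact: measurable_normal_pdf.
- by move=> x; rewrite !mule_ge0// lee_fin ?expR_ge0 ?normal_pdf_ge0.
apply: eq_integral => x _; rewrite -muleA -EFinM; congr (_ * _%:E).
rewrite !normal_pdf_sqrtE// mulrCA -expRD; congr (_ * expR _)%R.
by field; rewrite gt_eqF.
Qed.

Lemma gauss_sym (f : R -> \bar R) : (0 < v)%R ->
  measurable_fun setT f -> (forall x, 0 <= f x) ->
  \int[P]_t f (- X t)%R = \int[P]_t f (X t).
Proof.
move=> v0 mf f0.
rewrite (gauss_expectation_density (f := fun x => f (- x)%R))//; last first.
  by apply: measurableT_comp.
rewrite (gauss_expectation_density v0 mf)//.
rewrite -[RHS]ge0_integral_lebesgueN; last 2 first.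
- by apply: emeasurable_funM => //; apply/measurable_EFinP; exact: measurable_normal_pdf.
- by move=> x; rewrite !mule_ge0// lee_fin ?normal_pdf_ge0.
by apply: eq_integral => x _; rewrite !normal_pdf_sqrtE// !subr0 sqrrN.
Qed.

(** After completing the square, the integral is the total mass of a normal density. The map from p
    to p / (1 + p v) is the prediction half of the Riccati step. The case v = 0 is included because
    [Q] and [Pi0] may vanish; p may be negative, which gives exponential moments. *)
Lemma gauss_exp_quad (p q c : R) : (0 <= v)%R -> (0 < 1 + p * v)%R ->
  \int[P]_t (expR (- (p * (c + X t) ^+ 2) / 2 + q * (c + X t)))%:E =
  (expR (- (p / (1 + p * v) * c ^+ 2) / 2 + q / (1 + p * v) * c
     + (v / (1 + p * v) * q ^+ 2 - ln (1 + p * v)) / 2))%:E.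
Proof.
move=> v_ge0 pv0.
pose f (x : R) := (expR (- (p * (c + x) ^+ 2) / 2 + q * (c + x)))%:E.
have mf : measurable_fun setT f.
  apply/measurable_EFinP; apply: measurableT_comp => //.
  have mc : measurable_fun setT (fun x : R => (c + x)%R) by exact: measurable_funD.
  apply: measurable_funD; last exact: measurable_funM.
  apply: measurable_funM => //; apply: measurableT_comp => //.
  by apply: measurable_funM => //; exact: measurable_funX.
have f0 x : 0 <= f x by rewrite lee_fin expR_ge0.
rewrite -[LHS]/(\int[P]_t f (X t)).
have [v0|v0] := eqVneq v 0%R.
  rewrite (gauss_expectation_dirac (f := f))// /f v0; congr ((expR _)%:E).
  by rewrite mulr0 !addr0 ln1; field.
have {}v0 : (0 < v)%R by rewrite lt_def v0.
rewrite (gauss_expectation_density (f := f))//.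
set D := (1 + p * v)%R in pv0 *.
pose w := (v / D)%R; pose m := ((q - p * c) * w)%R.
have w0 : (0 < w)%R by rewrite divr_gt0.
set K := (X in _ = (expR X)%:E).
transitivity (\int[mu]_x ((expR K)%:E * (normal_pdf m (Num.sqrt w) x)%:E)).
  apply: eq_integral => x _; rewrite /f -!EFinM; congr (_%:E).
  rewrite !normal_pdf_sqrtE// subr0 mulrCA [RHS]mulrCA.
  have -> : ((Num.sqrt (w * pi *+ 2))^-1 = expR (ln D / 2) * (Num.sqrt (v * pi *+ 2))^-1)%R.
    have -> : (v * pi *+ 2 = D * (w * pi *+ 2))%R.
      by rewrite /w; field; rewrite gt_eqF.
    rewrite sqrtrM ?ltW// invfM mulrA.
    have -> : expR (ln D / 2) = Num.sqrt D.
      rewrite -[LHS]ger0_norm ?expR_ge0// -sqrtr_sqr -expRM_natl.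
      by rewrite mulrC divfK// lnK.
    by rewrite mulfV ?mul1r// gt_eqF// sqrtr_gt0.
  rewrite -mulrA -!expRD mulrCA -expRD; congr (_ * expR _)%R.
  by apply: gauss_complete_square; rewrite gt_eqF.
rewrite ge0_integralZl//.
- by rewrite integral_normal_pdf mule1.
- by apply/measurable_EFinP; exact: measurable_normal_pdf.
- by move=> x _; rewrite lee_fin normal_pdf_ge0.
Qed.

End gauss_expectation.

(** Taken from the density and not from a random variable, so that all the measurement noises share
    one constant. *)
Definition normal_moment4 (R : realType) (v : R) : R :=
  fine (\int[@lebesgue_measure R]_x ((x ^+ 4)%:E * (normal_pdf 0 (Num.sqrt v) x)%:E))%E.

Section gauss_moments.
Local Open Scope ereal_scope.
Context (R : realType) d (T : measurableType d) (P : probability T R)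
  (X : {RV P >-> R}) (v : R).
Hypothesis hX : has_gauss_law P X v.
Hypothesis v0 : (0 < v)%R.

Let mX n : measurable_fun setT (fun t => (X t ^+ n)%:E).
Proof. by apply/measurable_EFinP; exact: measurable_funX. Qed.

(** With u = x^2 / (8 v), x^4 = 64 v^2 u^2 is at most 64 v^2 exp (2 u), whose expectation is
    [gauss_exp_quad] at p = - 1 / (2 v), where 1 + p v = 1/2. *)
Lemma gauss_moment4_fin : \int[P]_t (X t ^+ 4)%:E < +oo.
Proof.
have pv : (0 < 1 + - (2 * v)^-1 * v)%R.
  by rewrite invfM mulNr mulfVK ?gt_eqF// subr_gt0 invf_lt1 ?ltr1n.
have := gauss_exp_quad hX 0 0 (ltW v0) pv; set K := expR _ => EK.
apply: (@le_lt_trans _ _ (\int[P]_t ((64 * v ^+ 2)%:E *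
   (expR (- (- (2 * v)^-1 * (0 + X t) ^+ 2) / 2 + 0 * (0 + X t)))%:E))).
  apply: ge0_le_integral => //.
  - by move=> t _; rewrite lee_fin exprn_even_ge0.
  - apply/measurable_EFinP; apply: measurable_funM => //.
    apply: measurableT_comp => //; apply: measurable_funD; last first.
      by apply: measurable_funM => //; exact: measurable_funD.
    apply: measurable_funM => //; apply: measurableT_comp => //.
    by apply: measurable_funM => //; apply: measurable_funX; exact: measurable_funD.
  - move=> t _; rewrite -EFinM lee_fin mul0r addr0 add0r.
    set x := X t.
    have -> : (- (- (2 * v)^-1 * x ^+ 2) / 2 = 2%:R * (x ^+ 2 / (8 * v)))%R.
      by field; rewrite gt_eqF.
    rewrite expRM_natl.
    have h : (x ^+ 2 / (8 * v) <= expR (x ^+ 2 / (8 * v)))%R.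
      by apply: le_trans (expR_ge1Dx _); rewrite lerDr.
    have -> : (x ^+ 4 = 64 * v ^+ 2 * (x ^+ 2 / (8 * v)) ^+ 2)%R.
      by field; rewrite gt_eqF.
    rewrite ler_pM2l ?mulr_gt0 ?exprn_gt0// ler_pXn2r// nnegrE ?expR_ge0//.
    by rewrite divr_ge0 ?sqr_ge0// mulr_ge0 ?ltW.
rewrite ge0_integralZl//.
- by rewrite EK -EFinM ltry.
- apply/measurable_EFinP; apply: measurableT_comp => //; apply: measurable_funD; last first.
    by apply: measurable_funM => //; exact: measurable_funD.
  apply: measurable_funM => //; apply: measurableT_comp => //.
  by apply: measurable_funM => //; apply: measurable_funX; exact: measurable_funD.
- by rewrite lee_fin mulr_ge0 ?sqr_ge0.
Qed.

Lemma gauss_moment2_fin : \int[P]_t (X t ^+ 2)%:E < +oo.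
Proof.
apply: (@le_lt_trans _ _ (\int[P]_t (1 + (X t ^+ 4)%:E))).
  apply: ge0_le_integral => //.
  - by move=> t _; rewrite lee_fin sqr_ge0.
  - exact: emeasurable_funD.
  - move=> t _; rewrite -EFinD lee_fin; set x := X t.
    by have := sqr_ge0 (x ^+ 2 - 1)%R; have := sqr_ge0 x; nra.
rewrite ge0_integralD//; last by move=> t _; rewrite lee_fin exprn_even_ge0.
by rewrite integral_probability_cst lte_add_pinfty ?ltry ?gauss_moment4_fin.
Qed.

(* The second moment is read off the Laplace transform of [X ^ 2] near 0. *)
Lemma gauss_moment2 : \int[P]_t (X t ^+ 2)%:E = v%:E.
Proof.
have e2 : \int[P]_t (X t ^+ 2)%:E \is a fin_num.
  rewrite ge0_fin_numE ?gauss_moment2_fin//; apply: integral_ge0 => t _.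
  by rewrite lee_fin sqr_ge0.
have e4 : \int[P]_t (X t ^+ 4)%:E \is a fin_num.
  rewrite ge0_fin_numE ?gauss_moment4_fin//; apply: integral_ge0 => t _.
  by rewrite lee_fin exprn_even_ge0.
rewrite -(fineK e2); congr (_%:E).
set a2 := fine _; set a4 := fine (\int[P]_t (X t ^+ 4)%:E).
have a4_ge0 : (0 <= a4)%R.
  by apply/fine_ge0/integral_ge0 => t _; rewrite lee_fin exprn_even_ge0.
have E p : (0 < p)%R -> \int[P]_t (expR (- (p * X t ^+ 2) / 2))%:E =
    ((Num.sqrt (1 + p * v))^-1)%:E.
  move=> p0; have D0 : (0 < 1 + p * v)%R by rewrite addr_gt0// mulr_gt0.
  have := gauss_exp_quad hX 0 0 (ltW v0) D0.
  under eq_integral do rewrite add0r mul0r addr0.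
  move=> ->; congr (_%:E).
  rewrite -[RHS]ger0_norm ?invr_ge0 ?sqrtr_ge0//.
  rewrite -[LHS]ger0_norm ?expR_ge0//.
  rewrite -!sqrtr_sqr; congr Num.sqrt; rewrite exprVn sqr_sqrtr ?ltW// -expRM_natl.
  have -> : (2%:R * (- (p / (1 + p * v) * 0 ^+ 2) / 2 + 0 / (1 + p * v) * 0 +
     (v / (1 + p * v) * 0 ^+ 2 - ln (1 + p * v)) / 2) = - ln (1 + p * v))%R.
    by move: (ln _) => L; field; rewrite gt_eqF.
  by rewrite expRN lnK.
have me p : measurable_fun setT (fun t => (expR (- (p * X t ^+ 2) / 2))%:E).
  apply/measurable_EFinP; apply: measurableT_comp => //.
  apply: measurable_funM => //; apply: measurableT_comp => //.
  by apply: measurable_funM => //; exact: measurable_funX.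
(* With y = p X^2 / 2, [lo] integrates 1 <= exp (- y) + y, and [hi] integrates exp (- y) + y <= 1 +
   y^2, which follows from exp (- y) <= 1 / (1 + y). Divided by p, they pin down [a2] as p tends to
   0. *)
have lo p : (0 < p)%R -> (1 <= (Num.sqrt (1 + p * v))^-1 + p * a2 / 2)%R.
  move=> p0; rewrite -lee_fin EFinD -E// mulrAC EFinM /a2 fineK//.
  rewrite -ge0_integralZl//; last 2 first.
  - by move=> t _; rewrite lee_fin sqr_ge0.
  - by rewrite lee_fin divr_ge0 ?ltW.
  rewrite -ge0_integralD//; last 2 first.
  - by move=> t _; rewrite -EFinM lee_fin mulr_ge0 ?sqr_ge0 ?divr_ge0 ?ltW.
  - exact: measurable_funeM.
  rewrite -[leLHS](integral_probability_cst P).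
  apply: ge0_le_integral => //.
  - by apply: emeasurable_funD => //; exact: measurable_funeM.
  - move=> t _; rewrite -EFinM -EFinD lee_fin.
    by have := expR_ge1Dx (- (p * X t ^+ 2) / 2); lra.
have hi p : (0 < p)%R ->
    ((Num.sqrt (1 + p * v))^-1 + p * a2 / 2 <= 1 + p ^+ 2 * a4 / 4)%R.
  move=> p0; rewrite -lee_fin !EFinD -E// mulrAC [(p ^+ 2 * a4 / 4)%R]mulrAC.
  rewrite !(EFinM _ a2) !(EFinM _ a4) /a2 /a4 !fineK//.
  rewrite -!ge0_integralZl//; try first
    [ by move=> t _; rewrite lee_fin exprn_even_ge0
    | by rewrite lee_fin divr_ge0 ?sqr_ge0 ?ltW ].
  rewrite -[in leRHS](integral_probability_cst P 1%:E).
  rewrite -!ge0_integralD//; try first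
    [ exact: measurable_funeM
    | by move=> t _; rewrite -EFinM lee_fin mulr_ge0
           ?exprn_even_ge0 ?divr_ge0 ?sqr_ge0 ?ltW ].
  apply: ge0_le_integral => //.
  - move=> t _; rewrite -EFinM -EFinD lee_fin addr_ge0 ?expR_ge0//.
    by rewrite mulr_ge0 ?sqr_ge0// divr_ge0 ?ltW.
  - by apply: emeasurable_funD => //; exact: measurable_funeM.
  - by apply: emeasurable_funD => //; exact: measurable_funeM.
  - move=> t _; rewrite -!EFinM -!EFinD lee_fin.
    set x := X t; set y := (p * x ^+ 2 / 2)%R.
    have y0 : (0 <= y)%R by rewrite divr_ge0// mulr_ge0 ?sqr_ge0 ?ltW.
    have -> : (- (p * x ^+ 2) / 2 = - y)%R by rewrite /y; field.
    have -> : (p / 2 * x ^+ 2 = y)%R by rewrite /y; field.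
    have -> : (p ^+ 2 / 4 * x ^+ 4 = y ^+ 2)%R by rewrite /y; field.
    have h : (1 + y <= expR y)%R := expR_ge1Dx y.
    have y1 : (0 < 1 + y)%R by lra.
    have : (expR (- y) <= (1 + y)^-1)%R by rewrite expRN lef_pV2// posrE expR_gt0.
    move=> /le_trans; rewrite -lerBrDr; apply.
    rewrite -[leLHS]mul1r ler_pdivrMr//; nra.
(* Naming the square root w and replacing p v by w^2 - 1 makes the remaining comparisons
   polynomial. *)
have sq p : (0 < p)%R -> exists w : R,
    [/\ (1 < w)%R, (w ^+ 2 = 1 + p * v)%R & w = Num.sqrt (1 + p * v)].
  move=> p0; have D1 : (1 < 1 + p * v)%R by rewrite ltrDl mulr_gt0.
  exists (Num.sqrt (1 + p * v)); rewrite sqr_sqrtr; last by lra.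
  by split=> //; rewrite -[ltLHS]sqrtr1 ltr_sqrt//; lra.
have a2_ge0 : (0 <= a2)%R.
  by apply/fine_ge0/integral_ge0 => t _; rewrite lee_fin sqr_ge0.
apply/eqP; rewrite eq_le; apply/andP; split.
  apply: (@ler_addMgt0 _ _ _ (a4 / 2)) => p p0 p1.
  have [w [w1 w2 ew]] := sq _ p0.
  have := hi _ p0; rewrite -ew => h.
  have hw : (1 - w^-1 <= p * v / 2)%R.
    have -> : (p * v = w ^+ 2 - 1)%R by rewrite w2; ring.
    have -> : (1 - w^-1 = (w - 1) / w)%R by field; lra.
    rewrite ler_pdivrMr; last by lra.
    have -> : ((w ^+ 2 - 1) / 2 * w = (w - 1) * ((w + 1) * w / 2))%R by field.
    by rewrite ler_peMr; nra.
  rewrite -(ler_pM2l p0); nra.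
apply: (@ler_addMgt0 _ _ _ (a2 * (2 * v + v ^+ 2))) => p p0 p1.
have [w [w1 w2 ew]] := sq _ p0.
have := lo _ p0; rewrite -ew => h.
have w12 : (w <= w ^+ 2)%R by nra.
have hw : (p * v <= (1 - w^-1) * (2 * (w ^+ 2) ^+ 2))%R.
  have -> : (p * v = w ^+ 2 - 1)%R by rewrite w2; ring.
  have -> : ((1 - w^-1) * (2 * (w ^+ 2) ^+ 2) = (w - 1) * (2 * (w * w ^+ 2)))%R.
    by field; lra.
  have -> : (w ^+ 2 - 1 = (w - 1) * (w + 1))%R by ring.
  by rewrite ler_pM2l; nra.
have h2 : (1 - w^-1 <= p * a2 / 2)%R by lra.
have : (p * v <= p * a2 / 2 * (2 * (w ^+ 2) ^+ 2))%R.
  by apply: (le_trans hw); rewrite ler_pM2r//; nra.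
have -> : (p * a2 / 2 * (2 * (w ^+ 2) ^+ 2) = p * (a2 * (w ^+ 2) ^+ 2))%R by field.
rewrite ler_pM2l// w2 => /le_trans; apply.
have -> : (a2 * (1 + p * v) ^+ 2 = a2 + p * (a2 * (2 * v + p * v ^+ 2)))%R by ring.
rewrite lerD2l ler_pM2l// ler_wpM2l// lerD2l ler_piMl// sqr_ge0.
by [].
Qed.

(* Only the finiteness of the fourth moment matters: it makes the squares
   [X ^ 2] obey the law of large numbers. *)
Lemma gauss_quad_sqr : (v ^+ 2 <= normal_moment4 v)%R /\
  forall A B C : R, \int[P]_t ((A + B * X t + C * X t ^+ 2) ^+ 2)%:E =
    (A ^+ 2 + (B ^+ 2 + 2 * A * C) * v + C ^+ 2 * normal_moment4 v)%:E.
Proof.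
have i2 : P.-integrable setT (fun t => (X t ^+ 2)%:E).
  apply/integrableP; split => //.
  under eq_integral do rewrite gee0_abs ?lee_fin ?sqr_ge0//.
  exact: gauss_moment2_fin.
have i4 : P.-integrable setT (fun t => (X t ^+ 4)%:E).
  apply/integrableP; split => //.
  under eq_integral do rewrite gee0_abs ?lee_fin ?exprn_even_ge0//.
  exact: gauss_moment4_fin.
have e4 : \int[P]_t (X t ^+ 4)%:E \is a fin_num by exact: integrable_fin_num.
set a4 := normal_moment4 v.
have a4E : a4 = fine (\int[P]_t (X t ^+ 4)%:E).
  rewrite (gauss_expectation_density hX (f := fun x => (x ^+ 4)%:E))//.
  - by apply/measurable_EFinP; exact: measurable_funX.
  - by move=> x; rewrite lee_fin exprn_even_ge0.
have ic (c : R) : P.-integrable setT (fun t : T => c%:E).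
  exact: finite_measure_integrable_cst.
suff H : forall A B C : R, \int[P]_t ((A + B * X t + C * X t ^+ 2) ^+ 2)%:E =
    (A ^+ 2 + (B ^+ 2 + 2 * A * C) * v + C ^+ 2 * a4)%:E.
  split => //.
  (* The lower bound on the fourth moment is the nonnegativity of the variance of X^2. *)
  have : 0 <= \int[P]_t ((- v + 0 * X t + 1 * X t ^+ 2) ^+ 2)%:E.
    by apply: integral_ge0 => t _; rewrite lee_fin sqr_ge0.
  by rewrite H lee_fin; nra.
move=> A B C.
pose F (x : R) := ((A + B * x + C * x ^+ 2) ^+ 2)%:E.
have mF : measurable_fun setT F.
  apply/measurable_EFinP; apply: measurable_funX; apply: measurable_funD.
    by apply: measurable_funD => //; exact: measurable_funM.
  by apply: measurable_funM => //; exact: measurable_funX.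
have F0 x : 0 <= F x by rewrite lee_fin sqr_ge0.
have mFX : measurable_fun setT (fun t => F (X t)).
  exact: (measurableT_comp mF).
have mFNX : measurable_fun setT (fun t => F (- X t)%R).
  by apply: (measurableT_comp mF); apply: measurableT_comp.
(* Averaging over X and - X cancels the odd powers before any integral is split, so the first and
   third moments never appear. *)
have : \int[P]_t F (X t) + \int[P]_t F (X t) =
    (2 * (A ^+ 2 + (B ^+ 2 + 2 * A * C) * v + C ^+ 2 * a4))%:E.
  rewrite -{1}(gauss_sym hX v0 mF F0) -ge0_integralD//.
  transitivity (\int[P]_t ((2 * A ^+ 2)%:E + ((2 * (B ^+ 2 + 2 * A * C))%:E * (X t ^+ 2)%:E
      + (2 * C ^+ 2)%:E * (X t ^+ 4)%:E))).
    apply: eq_integral => t _; rewrite /F -!EFinM -!EFinD; congr (_%:E); ring.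
  rewrite integralD//; last first.
    by apply: integrableD => //; exact: integrableZl.
  rewrite integralD//; [|exact: integrableZl|exact: integrableZl].
  rewrite !integralZl// gauss_moment2 integral_probability_cst -(fineK e4) -!EFinM -!EFinD.
  by congr (_%:E); rewrite -a4E; ring.
rewrite -[X in X = _ -> _]/(\int[P]_t F (X t) + \int[P]_t F (X t)).
change (\int[P]_t ((A + B * X t + C * X t ^+ 2) ^+ 2)%:E) with (\int[P]_t F (X t)).
case: (\int[P]_t F (X t)) => [r| |] //= [] h; congr (_%:E); lra.
Qed.

End gauss_moments.

(** * Resampling independent sources one at a time *)

Section cylinder.
Context (I : eqType) (R : realType).

(** Same shape as the events in [mutually_independent], so that independence gives the joint law on
    these sets directly; they generate the product sigma-algebra of the infinite family of
    sources. *)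
Definition cylinder : set (set (I -> R)) :=
  [set C | exists (J : seq I) (A : I -> set R), [/\ uniq J,
    forall i, measurable (A i) &
    C = \bigcap_(i in [set` J]) [set z : I -> R | A i (z i)]]].

Definition cylinderType := g_sigma_algebraType cylinder.

Lemma setI_closed_cylinder : setI_closed cylinder.
Proof.
move=> _ _ [J [A [uJ mA ->]]] [J' [A' [uJ' mA' ->]]].
pose B K (D : I -> set R) i := if i \in (K : seq I) then D i else setT.
exists (undup (J ++ J')), (fun i => B J A i `&` B J' A' i); split.
- exact: undup_uniq.
- by move=> i; apply: measurableI; rewrite /B; case: ifP.
apply/seteqP; split=> z /=.
- move=> [zA zA'] i; rewrite /= mem_undup mem_cat => iJ; rewrite /B.
  split; case: ifP => // h; [exact: zA|exact: zA'].
- move=> zB; split=> i /= iJ.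
  + have := zB i; rewrite /= mem_undup mem_cat iJ /B iJ => -[]//.
  + have := zB i; rewrite /= mem_undup mem_cat iJ orbT /B iJ => -[]//.
Qed.

Lemma measurable_coord (i : I) :
  measurable_fun setT (fun z : cylinderType => z i : R).
Proof.
move=> _ A mA; rewrite setTI; apply: sub_sigma_algebra.
exists [:: i], (fun=> A); split=> //.
by apply/seteqP; split=> z /=; [move=> ? j; rewrite /= inE => /eqP->|apply; rewrite /= inE].
Qed.

Lemma measurable_to_cylinder d (T : measurableType d) (f : T -> cylinderType) :
  (forall i, measurable_fun setT (fun t => f t i : R)) -> measurable_fun setT f.
Proof.
move=> mf; apply: (@measurability _ _ T cylinderType setT f cylinder erefl).
move=> _ [_ [J [A [uJ mA ->]]] <-].
rewrite setTI preimage_bigcap; apply: fin_bigcap_measurable => // i _.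
by rewrite -[X in measurable X]setTI; exact: mf.
Qed.

Definition update (z : I -> R) (k : I) (x : R) : I -> R :=
  fun i => if i == k then x else z i.

End cylinder.
Arguments cylinderType : clear implicits.

Section resampling.
Local Open Scope ereal_scope.
Context (R : realType) d (T : measurableType d) (P : probability T R)
  (I : eqType) (X : I -> {RV P >-> R}).
Hypothesis indX : mutually_independent P (fun i => X i : T -> R).

Definition sample (t : T) : cylinderType I R := fun i => X i t.

Lemma measurable_sample : measurable_fun setT sample.
Proof. by apply: measurable_to_cylinder => i. Qed.

HB.instance Definition _ := isMeasurableFun.Build _ _ _ _ sample measurable_sample.

Definition resample (k : I) (u : T * T) : cylinderType I R :=
  update (sample u.1) k (X k u.2).

Lemma measurable_resample k : measurable_fun setT (resample k).
Proof.
apply: measurable_to_cylinder => i; rewrite /resample /update.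
by case: (i == k); apply: measurableT_comp.
Qed.

HB.instance Definition _ k :=
  isMeasurableFun.Build _ _ _ _ (resample k) (measurable_resample k).

(** On a cylinder, independence splits off the factor of coordinate k, and the product measure
    splits it in the same way. Cylinders are stable under intersection, so the two laws coincide. *)
Lemma resample_law k (C : set (cylinderType I R)) : measurable C ->
  pushforward P sample C = pushforward (P \x P) (resample k) C.
Proof.
move=> mC.
apply: (@measure_unique _ R (cylinderType I R) (@cylinder I R) (fun=> setT) erefl
  (@setI_closed_cylinder I R) _ _ (pushforward P sample)
  (pushforward (P \x P) (resample k))) => //.
- move=> _; exists [::], (fun=> setT); split => //.
  by rewrite set_nil bigcap_set0.
- by rewrite bigcup_const.
- move=> _ [J [A [uJ mA ->]]].
  set C' := \bigcap_(i in _) _.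
  change (P (sample @^-1` C') = (P \x P) (resample k @^-1` C')); rewrite /C'.
  pose J' := [seq i <- J | i != k].
  pose B := if k \in J then X k @^-1` A k else setT.
  have -> : sample @^-1` (\bigcap_(i in [set` J]) [set z : I -> R | A i (z i)]) =
      \bigcap_(i in [set` J]) (X i @^-1` A i).
    by apply/seteqP; split=> t h i iJ; have := h i iJ.
  have -> : resample k @^-1` (\bigcap_(i in [set` J]) [set z : I -> R | A i (z i)]) =
      (\bigcap_(i in [set` J']) (X i @^-1` A i)) `*` B.
    apply/seteqP; split=> -[t t'] /=.
    - move=> h; split=> [i|].
        rewrite /= mem_filter => /andP[ik iJ].
        by have := h i iJ; rewrite /= /resample /update (negbTE ik).
      rewrite /B; case: ifPn => // kJ.
      by have := h k kJ; rewrite /= /resample /update eqxx.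
    - move=> [h hB] i /= iJ; rewrite /resample /update; case: ifPn => [/eqP ik|ik].
        by move: hB; rewrite /B -ik iJ.
      by apply: (h i); rewrite /= mem_filter ik.
  have mB : measurable B.
    by rewrite /B; case: ifP => // _; rewrite -[X in measurable X]setTI; exact: measurable_funPT.
  rewrite product_measure1E//; last first.
    apply: fin_bigcap_measurable => // i _.
    by rewrite -[X in measurable X]setTI; exact: measurable_funPT.
  have uJ' : uniq J' by exact: filter_uniq.
  have /= E := indX uJ mA; have /= E' := indX uJ' mA.
  rewrite [LHS]E [X in _ = X * _]E'.
  rewrite /B; case: ifPn => kJ.
    by rewrite (bigD1_seq k)//= big_filter muleC.
  rewrite probability_setT mule1 big_filter big_seq_cond [RHS]big_seq_cond.
  apply: eq_bigl => i; case: (boolP (i \in J)) => //= iJ.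
  by apply/esym; apply: contraNneq kJ => <-.
- by move=> _; rewrite -[ltLHS]/(P (sample @^-1` setT)) preimage_setT probability_setT ltry.
Qed.

Lemma ge0_integral_resample k (F : cylinderType I R -> \bar R) :
  measurable_fun setT F -> (forall z, 0 <= F z) ->
  \int[P]_t F (sample t) = \int[P]_t \int[P]_t' F (update (sample t) k (X k t')).
Proof.
move=> mF F0.
transitivity (\int[pushforward P sample]_z F z).
  by rewrite ge0_integral_pushforward ?preimage_setT//; exact: measurable_sample.
transitivity (\int[pushforward (P \x P) (resample k)]_z F z).
  by apply: eq_measure_integral => A mA _; exact: resample_law.
rewrite (ge0_integral_pushforward (measurable_resample k)) ?preimage_setT//.
rewrite fubini_tonelli1//.
- by apply: measurableT_comp => //; exact: measurable_resample.
- by move=> u; exact: F0.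
Qed.

(** This plays the part of conditioning on all sources but the k-th: it suffices to compare the
    integrals over that one source, the rest of [z] being constant. *)
Lemma ge0_eq_integral_resample k (F G : cylinderType I R -> \bar R) :
  measurable_fun setT F -> (forall z, 0 <= F z) ->
  measurable_fun setT G -> (forall z, 0 <= G z) ->
  (forall z : cylinderType I R,
    \int[P]_t F (update z k (X k t)) = \int[P]_t G (update z k (X k t))) ->
  \int[P]_t F (sample t) = \int[P]_t G (sample t).
Proof.
move=> mF F0 mG G0 FG.
rewrite (ge0_integral_resample k mF F0) (ge0_integral_resample k mG G0).
by apply: eq_integral => t _; exact: FG.
Qed.

End resampling.

(** * The likelihood ratio of the two hypotheses *)

Section riccati.
Context {F : realFieldType}.
Variables (v a Q : F).

(* For fixed observations, the conditional likelihood ratio of [y_k, ...,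
   y_{k+j-1}] given the signal value [s] at time [k] is
   [exp (- (prec j * s ^ 2) / 2 + drift y k j * s + const)], with [const]
   equal to [offset y k j] (a logarithm, defined over the reals below). *)
Fixpoint prec (j : nat) : F :=
  if j is j'.+1 then v^-1 + a ^+ 2 * (prec j' / (1 + prec j' * Q)) else 0.

Fixpoint drift (y : nat -> F) (k j : nat) : F :=
  if j is j'.+1 then y k / v + a * (drift y k.+1 j' / (1 + prec j' * Q)) else 0.

Lemma prec_ge0 j : 0 < v -> 0 <= Q -> 0 <= prec j.
Proof.
move=> v0 Q0; elim: j => //= j IH.
by rewrite addr_ge0 ?invr_ge0 ?(ltW v0)// mulr_ge0 ?sqr_ge0// divr_ge0// addr_ge0// mulr_ge0.
Qed.

Lemma prec_den_gt0 j : 0 < v -> 0 <= Q -> 0 < 1 + prec j * Q.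
Proof. by move=> v0 Q0; rewrite ltr_pwDl// mulr_ge0 ?prec_ge0. Qed.

Lemma eq_drift_in y y' k j : (forall i, (k <= i < k + j)%N -> y i = y' i) ->
  drift y k j = drift y' k j.
Proof.
elim: j k => //= j IH k h; rewrite h ?leqnn ?addnS ?ltnS ?leq_addr// (IH k.+1)//.
by move=> i /andP[ki ij]; apply: h; rewrite ltnW// addnS -addSn.
Qed.

Lemma eq_drift y y' k j : (forall i, (k <= i)%N -> y i = y' i) ->
  drift y k j = drift y' k j.
Proof. by move=> h; apply: eq_drift_in => i /andP[ki _]; exact: h. Qed.

End riccati.

Section log_likelihood.
Context {R : realType}.
Variables (v a Q : R).

Fixpoint offset (y : nat -> R) (k j : nat) : R :=
  if j is j'.+1 then
    offset y k.+1 j' + (Q / (1 + prec v a Q j' * Q) * drift v a Q y k.+1 j' ^+ 2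
      - ln (1 + prec v a Q j' * Q)) / 2
  else 0.

Lemma eq_offset_in y y' k j : (forall i, (k <= i < k + j)%N -> y i = y' i) ->
  offset y k j = offset y' k j.
Proof.
elim: j k => //= j IH k h.
have h' i : (k.+1 <= i < k.+1 + j)%N -> y i = y' i.
  by move=> /andP[ki ij]; apply: h; rewrite ltnW// addnS -addSn.
by rewrite (IH k.+1)// (eq_drift_in _ _ _ h').
Qed.

Lemma eq_offset y y' k j : (forall i, (k <= i)%N -> y i = y' i) ->
  offset y k j = offset y' k j.
Proof. by move=> h; apply: eq_offset_in => i /andP[ki _]; exact: h. Qed.

(** The last integration is over the initial signal: [gauss_exp_quad] with centre 0 and prior
    variance [Pi0] in place of [Q]. *)
Definition log_lr (Pi0 : R) (n : nat) (y : nat -> R) : R :=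
  offset y 0 n + (Pi0 / (1 + prec v a Q n * Pi0) * drift v a Q y 0 n ^+ 2
    - ln (1 + prec v a Q n * Pi0)) / 2.

Lemma eq_log_lr Pi0 n y y' : (forall i, (i < n)%N -> y i = y' i) ->
  log_lr Pi0 n y = log_lr Pi0 n y'.
Proof.
move=> h; have h' i : (0 <= i < 0 + n)%N -> y i = y' i by move=> /andP[_]; exact: h.
by rewrite /log_lr (eq_offset_in h') (eq_drift_in _ _ _ h').
Qed.

Section measurability.
Context d (T : measurableType d) (y : T -> nat -> R).
Hypothesis my : forall i, measurable_fun setT (fun t => y t i).

Lemma measurable_drift k j : measurable_fun setT (fun t => drift v a Q (y t) k j).
Proof.
elim: j k => [|j IH] k /=; first exact: measurable_cst.
apply: measurable_funD; first exact: measurable_funM.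
by apply: measurable_funM => //; exact: measurable_funM.
Qed.

Lemma measurable_offset k j : measurable_fun setT (fun t => offset (y t) k j).
Proof.
elim: j k => [|j IH] k /=; first exact: measurable_cst.
apply: measurable_funD => //; apply: measurable_funM => //.
apply: measurable_funB => //; apply: measurable_funM => //.
by apply: measurable_funX; exact: measurable_drift.
Qed.

Lemma measurable_log_lr Pi0 n : measurable_fun setT (fun t => log_lr Pi0 n (y t)).
Proof.
apply: measurable_funD; first exact: measurable_offset.
apply: measurable_funM => //; apply: measurable_funB => //.
by apply: measurable_funM => //; apply: measurable_funX; exact: measurable_drift.
Qed.

End measurability.

End log_likelihood.

Section sources.
Context {R : realType}.
Notation idx := (option (nat + nat)).
Implicit Types z : cylinderType idx R.
Variables (v Pi0 a : R).
Notation Q := (Pi0 * (1 - a ^+ 2)).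

Fixpoint signal_of z (i : nat) : R :=
  if i is j.+1 then a * signal_of z j + z (Some (inl j)) else z None.

Definition noise_of z (i : nat) : R := z (Some (inr i)).

Lemma measurable_noise_of i : measurable_fun setT (fun z => noise_of z i).
Proof. exact: measurable_coord. Qed.

Lemma measurable_signal_of i : measurable_fun setT (fun z => signal_of z i).
Proof.
elim: i => [|i IH] /=; first exact: measurable_coord.
by apply: measurable_funD; [exact: measurable_funM|exact: measurable_coord].
Qed.

Lemma eq_signal_of z z' i : z None = z' None ->
  (forall j, (j < i)%N -> z (Some (inl j)) = z' (Some (inl j))) ->
  signal_of z i = signal_of z' i.
Proof.
move=> h0; elim: i => //= i IH h; rewrite IH ?h// => j ji; apply: h; exact: ltnW.
Qed.

(* Observations following [H1] before time [k] and [H0] from time [k] on. *)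
Definition hybrid_obs n k z : n.-tuple R :=
  [tuple (if (i < k)%N then signal_of z i else 0) + noise_of z i | i < n].

Lemma measurable_hybrid_obs n k : measurable_fun setT (hybrid_obs n k).
Proof.
apply/measurable_fun_tnthP => i.
rewrite (_ : _ \o _ = fun z => (if (i < k)%N then signal_of z i else 0) + noise_of z i);
  last by apply/funext => z; rewrite /= tnth_mktuple.
apply: measurable_funD; last exact: measurable_noise_of.
by case: (nat_of_ord i < k)%N => //; exact: measurable_signal_of.
Qed.

End sources.

Section change_of_measure.
Context {R : realType}.
Variables (v Pi0 a : R) (S : gm_system R).
Hypotheses (v0 : 0 < v) (Pi00 : 0 <= Pi0) (a01 : 0 <= a <= 1).
Hypothesis hS : gm_model v Pi0 a S.
Notation Q := (Pi0 * (1 - a ^+ 2)).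
Notation P := (gm_P S).
Notation idx := (option (nat + nat)).
Implicit Types z : cylinderType idx R.

Lemma process_var_ge0 : 0 <= Q.
Proof. by move/andP: a01 => [a0 a1]; rewrite mulr_ge0// subr_ge0 expr_le1. Qed.
Let Q0 := process_var_ge0.

Definition gm_rv (k : idx) : {RV P >-> R} :=
  match k with
  | None => gm_s1 S
  | Some (inl i) => gm_u S i
  | Some (inr i) => gm_w S i
  end.

Lemma gm_rv_indep : mutually_independent P (fun k => gm_rv k : gm_T S -> R).
Proof.
have [_ _ _] := hS; congr mutually_independent.
by apply/funext => -[[i|i]|].
Qed.

Definition gm_sample : gm_T S -> cylinderType idx R := sample gm_rv.

Lemma signal_of_sample i t : signal_of a (gm_sample t) i = gm_signal a i t.
Proof. by elim: i => //= i ->. Qed.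

Lemma obs_H1_hybrid n t : obs_H1 a n t = hybrid_obs a n n (gm_sample t).
Proof. by apply: eq_mktuple => i; rewrite ltn_ord signal_of_sample. Qed.

Lemma obs_H0_hybrid n t : @obs_H0 R S n t = hybrid_obs a n 0 (gm_sample t).
Proof. by apply: eq_mktuple => i; rewrite add0r. Qed.

Let mS k : measurable_fun setT (fun z => signal_of a z k).
Proof. exact: measurable_signal_of. Qed.

Let mdr k j : measurable_fun setT (fun z => drift v a Q (noise_of z) k j).
Proof. by apply: measurable_drift => i; exact: measurable_noise_of. Qed.

Let moff k j : measurable_fun setT (fun z => offset v a Q (noise_of z) k j).
Proof. by apply: measurable_offset => i; exact: measurable_noise_of. Qed.

Section fixed_region.
Variables (n : nat) (D : set (n.-tuple R)).
Hypothesis mD : measurable D.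

(** Used with j + k = n: the signal is kept in the first k observations, and its effect on the last
    j is carried by their likelihood ratio given the signal at time k. [predicted_lr j k] is the
    stage in between, where time k still contains the signal and the process noise [u_k] has been
    integrated out. *)
Definition partial_lr j k z : \bar R :=
  (\1_D (hybrid_obs a n k z) *
   expR (- (prec v a Q j * signal_of a z k ^+ 2) / 2
     + drift v a Q (noise_of z) k j * signal_of a z k
     + offset v a Q (noise_of z) k j))%:E.

Definition predicted_lr j k z : \bar R :=
  (\1_D (hybrid_obs a n k.+1 z) *
   expR (- (prec v a Q j / (1 + prec v a Q j * Q) * (a * signal_of a z k) ^+ 2) / 2
     + drift v a Q (noise_of z) k.+1 j / (1 + prec v a Q j * Q) * (a * signal_of a z k)
     + (Q / (1 + prec v a Q j * Q) * drift v a Q (noise_of z) k.+1 j ^+ 2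
        - ln (1 + prec v a Q j * Q)) / 2
     + offset v a Q (noise_of z) k.+1 j))%:E.

Definition full_lr z : \bar R :=
  (\1_D (hybrid_obs a n 0 z) * expR (log_lr v a Q Pi0 n (noise_of z)))%:E.

Let m1 k : measurable_fun setT (fun z => \1_D (hybrid_obs a n k z) : R).
Proof.
by apply: (measurableT_comp (measurable_indic mD)); exact: measurable_hybrid_obs.
Qed.

Lemma measurable_partial_lr j k : measurable_fun setT (partial_lr j k).
Proof.
apply/measurable_EFinP; apply: measurable_funM => //.
apply: measurableT_comp => //; apply: measurable_funD => //.
apply: measurable_funD; last exact: measurable_funM.
apply: measurable_funM => //; apply: measurableT_comp => //.
by apply: measurable_funM => //; exact: measurable_funX.
Qed.

Lemma measurable_predicted_lr j k : measurable_fun setT (predicted_lr j k).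
Proof.
apply/measurable_EFinP; apply: measurable_funM => //.
have ms : measurable_fun setT (fun z => a * signal_of a z k) by exact: measurable_funM.
apply: measurableT_comp => //; apply: measurable_funD => //.
apply: measurable_funD; last first.
  apply: measurable_funM => //; apply: measurable_funB => //.
  by apply: measurable_funM => //; exact: measurable_funX.
apply: measurable_funD; last by apply: measurable_funM => //; exact: measurable_funM.
apply: measurable_funM => //; apply: measurableT_comp => //.
by apply: measurable_funM => //; exact: measurable_funX.
Qed.

Lemma measurable_full_lr : measurable_fun setT full_lr.
Proof.
apply/measurable_EFinP; apply: measurable_funM => //.
apply: measurableT_comp => //; apply: measurable_funD => //.
apply: measurable_funM => //; apply: measurable_funB => //.
by apply: measurable_funM => //; exact: measurable_funX.
Qed.

Lemma partial_lr_ge0 j k z : (0 <= partial_lr j k z)%E.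
Proof. by rewrite lee_fin mulr_ge0 ?expR_ge0. Qed.

Lemma predicted_lr_ge0 j k z : (0 <= predicted_lr j k z)%E.
Proof. by rewrite lee_fin mulr_ge0 ?expR_ge0. Qed.

Lemma full_lr_ge0 z : (0 <= full_lr z)%E.
Proof. by rewrite lee_fin mulr_ge0 ?expR_ge0. Qed.

Lemma update_u z k x : let z' := update z (Some (inl k)) x : cylinderType idx R in
  [/\ noise_of z' = noise_of z, forall i, (i <= k)%N -> signal_of a z' i = signal_of a z i
    & signal_of a z' k.+1 = a * signal_of a z k + x].
Proof.
move=> z'.
have hS' i : (i <= k)%N -> signal_of a z' i = signal_of a z i.
  move=> ik; apply: eq_signal_of => // j ji; rewrite /z' /update ifN//.
  by apply: contraTneq (leq_trans ji ik) => -[->]; rewrite ltnn.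
split => //.
by rewrite /= hS'// /z' /update eqxx.
Qed.

Lemma update_w z k x : let z' := update z (Some (inr k)) x : cylinderType idx R in
  [/\ forall i, (k < i)%N -> noise_of z' i = noise_of z i, noise_of z' k = x,
    forall i, i != k -> noise_of z' i = noise_of z i
    & forall i, signal_of a z' i = signal_of a z i].
Proof.
move=> z'.
have h i : i != k -> noise_of z' i = noise_of z i.
  by move=> ik; rewrite /noise_of /z' /update ifN//; apply: contra ik => /eqP[->].
split => //.
- by move=> i ki; apply: h; rewrite gtn_eqF.
- by rewrite /noise_of /z' /update eqxx.
- by move=> i; apply: eq_signal_of.
Qed.

(** The noise [u_k] enters only through the signal at time k + 1, which here occurs in the exponent
    and not in the hybrid observations. Its integral is therefore a single [gauss_exp_quad] centred
    at a s_k. *)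
Lemma integral_partial_predicted j k :
  (\int[P]_t partial_lr j k.+1 (gm_sample t) =
   \int[P]_t predicted_lr j k (gm_sample t))%E.
Proof.
apply: (ge0_eq_integral_resample gm_rv_indep (k := Some (inl k))).
- exact: measurable_partial_lr.
- exact: partial_lr_ge0.
- exact: measurable_predicted_lr.
- exact: predicted_lr_ge0.
move=> z.
have hyb x : hybrid_obs a n k.+1 (update z (Some (inl k)) x) = hybrid_obs a n k.+1 z.
  have [hn hs _] := update_u z k x.
  apply: eq_mktuple => i; rewrite hn ltnS; congr (_ + _).
  by case: ifP => // ik; rewrite hs.
have p1 := prec_den_gt0 a j v0 Q0.
have [_ hu _ _] := hS.
set p := prec v a Q j in p1 *.
pose q := drift v a Q (noise_of z) k.+1 j; pose s := signal_of a z k.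
pose K := \1_D (hybrid_obs a n k.+1 z) * expR (offset v a Q (noise_of z) k.+1 j).
transitivity (\int[P]_t (K%:E * (expR (- (p * (a * s + gm_u S k t) ^+ 2) / 2
    + q * (a * s + gm_u S k t)))%:E))%E.
  apply: eq_integral => t _; have [hn hs hs'] := update_u z k (gm_u S k t).
  rewrite /partial_lr hyb hn hs' -EFinM; congr (_%:E).
  by rewrite expRD /K -/p -/q -/s; ring.
rewrite ge0_integralZl//; last 2 first.
- apply/measurable_EFinP; apply: measurableT_comp => //.
  have ms : measurable_fun setT (fun t => a * s + gm_u S k t) by exact: measurable_funD.
  apply: measurable_funD; last exact: measurable_funM.
  apply: measurable_funM => //; apply: measurableT_comp => //.
  by apply: measurable_funM => //; exact: measurable_funX.
- by rewrite lee_fin mulr_ge0 ?expR_ge0.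
rewrite (gauss_exp_quad (hu k))//.
rewrite -[LHS](integral_probability_cst P).
apply: eq_integral => t _; have [hn hs hs'] := update_u z k (gm_u S k t).
rewrite /predicted_lr hyb hn hs// -EFinM; congr (_%:E).
by rewrite -/p -/q -/s [in RHS]expRD /K; ring.
Qed.

(** The noise [w_k] occurs only in the k-th observation, since [drift] and [offset] start at k + 1.
    Shifting it by s_k removes the signal there; the factor exp ((s w - s^2 / 2) / v) adds 1 / v to
    the precision and y_k / v to the drift. *)
Lemma integral_predicted_partial j k :
  (\int[P]_t predicted_lr j k (gm_sample t) =
   \int[P]_t partial_lr j.+1 k (gm_sample t))%E.
Proof.
apply: (ge0_eq_integral_resample gm_rv_indep (k := Some (inr k))).
- exact: measurable_predicted_lr.
- exact: predicted_lr_ge0.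
- exact: measurable_partial_lr.
- exact: partial_lr_ge0.
move=> z.
have hyb x : hybrid_obs a n k.+1 (update z (Some (inr k)) x) =
    hybrid_obs a n k (update z (Some (inr k)) (signal_of a z k + x)).
  have [_ h1 h2 h3] := update_w z k x.
  have [_ h1' h2' h3'] := update_w z k (signal_of a z k + x).
  apply: eq_mktuple => i; rewrite h3 h3' ltnS.
  case: (ltngtP i k) => ik; rewrite ?add0r.
  - by rewrite h2 ?h2' ?ltn_eqF.
  - by rewrite h2 ?h2' ?gtn_eqF.
  - by rewrite ik h1 h1'.
have [_ _ hw _] := hS.
set p := prec v a Q j.
pose q := drift v a Q (noise_of z) k.+1 j; pose s := signal_of a z k.
pose c := - (p / (1 + p * Q) * (a * s) ^+ 2) / 2 + q / (1 + p * Q) * (a * s) +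
  (Q / (1 + p * Q) * q ^+ 2 - ln (1 + p * Q)) / 2 + offset v a Q (noise_of z) k.+1 j.
pose f (x : R) := (\1_D (hybrid_obs a n k (update z (Some (inr k)) x)) * expR c)%:E.
have mf : measurable_fun setT f.
  apply/measurable_EFinP; apply: measurable_funM => //.
  apply: (measurableT_comp (m1 k)); apply: measurable_to_cylinder => i.
  by rewrite /update; case: (i == _).
transitivity (\int[P]_t f (s + gm_w S k t)%R)%E.
  apply: eq_integral => t _.
  have [h1 h2 h3 h4] := update_w z k (gm_w S k t).
  rewrite /predicted_lr hyb h4 (eq_drift _ _ _ _ h1) (eq_offset _ _ _ _ h1).
  by rewrite /f /c -/p -/q -/s.
rewrite (gauss_shift (hw k))//; last by move=> x; rewrite lee_fin mulr_ge0 ?expR_ge0.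
apply: eq_integral => t _.
have [h1 h2 h3 h4] := update_w z k (gm_w S k t).
rewrite /partial_lr /= h4 h2 (eq_drift _ _ _ _ h1) (eq_offset _ _ _ _ h1).
rewrite /f -EFinM -/p -/q -/s; congr (_%:E).
rewrite -[LHS]mulrA -expRD; congr (_ * expR _).
rewrite /c; move: (ln _) => L.
have p1 := prec_den_gt0 a j v0 Q0; rewrite -/p in p1.
by field; rewrite !gt_eqF.
Qed.

Lemma integral_partial_full :
  (\int[P]_t partial_lr n 0 (gm_sample t) = \int[P]_t full_lr (gm_sample t))%E.
Proof.
apply: (ge0_eq_integral_resample gm_rv_indep (k := None)).
- exact: measurable_partial_lr.
- exact: partial_lr_ge0.
- exact: measurable_full_lr.
- exact: full_lr_ge0.
move=> z.
have hyb x : hybrid_obs a n 0 (update z None x) = hybrid_obs a n 0 z.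
  by apply: eq_mktuple => i.
have p1 : 0 < 1 + prec v a Q n * Pi0.
  by rewrite ltr_pwDl// mulr_ge0 ?prec_ge0.
have [h1 _ _ _] := hS.
set p := prec v a Q n in p1 *.
pose q := drift v a Q (noise_of z) 0 n.
pose K := \1_D (hybrid_obs a n 0 z) * expR (offset v a Q (noise_of z) 0 n).
transitivity (\int[P]_t (K%:E * (expR (- (p * (0 + gm_s1 S t) ^+ 2) / 2
    + q * (0 + gm_s1 S t)))%:E))%E.
  apply: eq_integral => t _.
  rewrite /partial_lr hyb -EFinM; congr (_%:E).
  by rewrite add0r [in LHS]expRD /K -/p -/q /=; ring.
rewrite ge0_integralZl//; last 2 first.
- apply/measurable_EFinP; apply: measurableT_comp => //.
  have ms : measurable_fun setT (fun t => 0 + gm_s1 S t) by exact: measurable_funD.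
  apply: measurable_funD; last exact: measurable_funM.
  apply: measurable_funM => //; apply: measurableT_comp => //.
  by apply: measurable_funM => //; exact: measurable_funX.
- by rewrite lee_fin mulr_ge0 ?expR_ge0.
rewrite (gauss_exp_quad h1)//.
rewrite -[LHS](integral_probability_cst P).
apply: eq_integral => t _.
rewrite /full_lr hyb /log_lr -EFinM; congr (_%:E).
rewrite -/p -[noise_of (update _ _ _)]/(noise_of z) -/q !(expr0n, mulr0, mul0r, oppr0, add0r) /=.
by rewrite [in RHS]expRD /K; ring.
Qed.

Lemma prob_obs_H1 : (P (@obs_H1 R a S n @^-1` D) =
  \int[P]_t (\1_D (@obs_H0 R S n t) *
    expR (log_lr v a Q Pi0 n (noise_of (gm_sample t))))%:E)%E.
Proof.
transitivity (\int[P]_t partial_lr 0 n (gm_sample t))%E.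
  have -> : @obs_H1 R a S n @^-1` D = (hybrid_obs a n n \o gm_sample) @^-1` D.
    by apply/seteqP; split=> t /=; rewrite obs_H1_hybrid.
  rewrite -(setIT ((hybrid_obs a n n \o gm_sample) @^-1` D)) -integral_indic//; last first.
    have mH : measurable_fun setT (hybrid_obs a n n \o gm_sample).
      have ms : measurable_fun setT gm_sample by exact: measurable_sample.
      exact: (measurableT_comp (@measurable_hybrid_obs R a n n) ms).
    by rewrite -[X in measurable X]setTI; exact: mH.
  apply: eq_integral => t _; congr (_%:E).
  rewrite /= !mul0r oppr0 mul0r !addr0 expR0 mulr1.
  by rewrite !indicE; congr (_%:R); apply/idP/idP; rewrite !inE.
(* One induction step integrates out the process noise and then shifts the measurement noise, both
   of index n - j - 1. *)
have H j : (j <= n)%N ->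
    (\int[P]_t partial_lr 0 n (gm_sample t) = \int[P]_t partial_lr j (n - j) (gm_sample t))%E.
  elim: j => [|j IH] jn; first by rewrite subn0.
  rewrite IH; last exact: ltnW.
  rewrite -(subnSK jn) integral_partial_predicted.
  by rewrite integral_predicted_partial.
rewrite (H n (leqnn _)) subnn integral_partial_full.
by apply: eq_integral => t _; rewrite /full_lr obs_H0_hybrid.
Qed.

End fixed_region.

End change_of_measure.

(** * The log-likelihood ratio under the noise hypothesis *)

Section concentration.
Context {R : realType}.
Variables (v Pi0 a : R) (S : gm_system R).
Hypotheses (v0 : 0 < v) (Pi00 : 0 <= Pi0) (a01 : 0 <= a <= 1).
Hypothesis hS : gm_model v Pi0 a S.
Notation Q := (Pi0 * (1 - a ^+ 2)).
Notation P := (gm_P S).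
Notation idx := (option (nat + nat)).
Implicit Types z : cylinderType idx R.
Notation Y := (@gm_sample R S).
Notation prec := (prec v a Q).
Notation drift := (drift v a Q).

Let Q0 : 0 <= Q := process_var_ge0 Pi00 a01.

Let mdr k j : measurable_fun setT (fun z => drift (noise_of z) k j).
Proof. by apply: measurable_drift => i; exact: measurable_noise_of. Qed.

Let mno i : measurable_fun setT (fun z => noise_of z i).
Proof. exact: measurable_noise_of. Qed.

Let mY (f : cylinderType idx R -> \bar R) : measurable_fun setT f ->
  measurable_fun setT (fun t => f (Y t)).
Proof.
move=> mf; have ms : measurable_fun setT Y by exact: measurable_sample.
exact: (measurableT_comp mf ms).
Qed.

(** Each second moment below is that of a polynomial of degree at most 2 in one noise [w_k], with
    coefficients A, B, C that depend on the other sources; g is its mean over [w_k]. *)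
Lemma integral_resample_w k (f g : cylinderType idx R -> R) :
  measurable_fun setT f -> (forall z, 0 <= f z) ->
  measurable_fun setT g -> (forall z, 0 <= g z) ->
  (forall z, exists A B C : R,
    (forall x, f (update z (Some (inr k)) x) = (A + B * x + C * x ^+ 2) ^+ 2) /\
    (forall x, g (update z (Some (inr k)) x) =
      A ^+ 2 + (B ^+ 2 + 2 * A * C) * v + C ^+ 2 * normal_moment4 v)) ->
  (\int[P]_t (f (Y t))%:E = \int[P]_t (g (Y t))%:E)%E.
Proof.
move=> mf f0 mg g0 fg.
apply: (ge0_eq_integral_resample (gm_rv_indep hS) (k := Some (inr k))
  (F := fun z => (f z)%:E) (G := fun z => (g z)%:E)).
- exact/measurable_EFinP.
- by move=> z; rewrite lee_fin.
- exact/measurable_EFinP.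
- by move=> z; rewrite lee_fin.
move=> z; have [A [B [C [hf hg]]]] := fg z.
have [_ _ hw _] := hS.
have [_ hq] := gauss_quad_sqr (hw k) v0.
under eq_integral do rewrite hf.
rewrite hq -[LHS](integral_probability_cst P).
by apply: eq_integral => t _; rewrite hg.
Qed.

Lemma integral_drift_step k j :
  (\int[P]_t (drift (noise_of (Y t)) k j.+1 ^+ 2)%:E =
   (v^-1)%:E + ((a / (1 + prec j * Q)) ^+ 2)%:E *
     \int[P]_t (drift (noise_of (Y t)) k.+1 j ^+ 2)%:E)%E.
Proof.
transitivity (\int[P]_t (v^-1 +
    (a / (1 + prec j * Q)) ^+ 2 * drift (noise_of (Y t)) k.+1 j ^+ 2)%:E)%E.
  apply: (integral_resample_w (k := k) (f := fun z => drift (noise_of z) k j.+1 ^+ 2)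
    (g := fun z => v^-1 + (a / (1 + prec j * Q)) ^+ 2 * drift (noise_of z) k.+1 j ^+ 2)).
  - exact: measurable_funX.
  - by move=> z; exact: sqr_ge0.
  - by apply: measurable_funD => //; apply: measurable_funM => //; exact: measurable_funX.
  - by move=> z; apply: addr_ge0; [rewrite invr_ge0 ltW|rewrite mulr_ge0 ?sqr_ge0].
  move=> z; exists (a * (drift (noise_of z) k.+1 j / (1 + prec j * Q))), v^-1, 0.
  split=> x; have [h1 h2 _ _] := update_w a z k x.
    by rewrite /= h2 (eq_drift _ _ _ _ h1) mul0r addr0; congr (_ ^+ 2); ring.
  rewrite (eq_drift _ _ _ _ h1); have p1 := prec_den_gt0 a j v0 Q0.
  by field; rewrite !gt_eqF.
under eq_integral do rewrite EFinD EFinM.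
have m2 : measurable_fun setT (fun t => (drift (noise_of (Y t)) k.+1 j ^+ 2)%:E).
  apply: (mY (f := fun z => (drift (noise_of z) k.+1 j ^+ 2)%:E)).
  by apply/measurable_EFinP; exact: measurable_funX.
rewrite ge0_integralD//; first last.
- exact: measurable_funeM.
- by move=> t _; rewrite -EFinM lee_fin mulr_ge0 ?sqr_ge0.
- by move=> t _; rewrite lee_fin invr_ge0 ltW.
rewrite integral_probability_cst ge0_integralZl//.
- by move=> t _; rewrite lee_fin sqr_ge0.
- by rewrite lee_fin sqr_ge0.
Qed.

(** The second moment obeys the recursion of [prec] up to an additional factor 1 / (1 + prec j * Q),
    which is at most 1. *)
Lemma integral_drift_sqr k j :
  (\int[P]_t (drift (noise_of (Y t)) k j ^+ 2)%:E <= (prec j)%:E)%E.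
Proof.
elim: j k => [|j IH] k.
  by under eq_integral do rewrite /= expr0n/=; rewrite integral0.
rewrite integral_drift_step /= EFinD leeD2l//.
apply: (@le_trans _ _ (((a / (1 + prec j * Q)) ^+ 2)%:E * (prec j)%:E)%E).
  by rewrite lee_wpmul2l// lee_fin sqr_ge0.
rewrite -EFinM lee_fin.
have p1 := prec_den_gt0 a j v0 Q0; have p0 := prec_ge0 a j v0 Q0.
have D1 : 1 <= 1 + prec j * Q by rewrite lerDl mulr_ge0.
have -> : (a / (1 + prec j * Q)) ^+ 2 * prec j =
   a ^+ 2 * (prec j / (1 + prec j * Q)) / (1 + prec j * Q) by field; rewrite gt_eqF.
by rewrite ler_pdivrMr// ler_peMr// mulr_ge0 ?sqr_ge0 ?divr_ge0// ltW.
Qed.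

(* Normalising [y_k ^ 2] and centring the cross term in the square of the
   recursion for [drift] gives martingale increments. *)
Fixpoint drift_mart z (k j : nat) : R :=
  if j is j'.+1 then drift_mart z k.+1 j' +
    ((noise_of z k ^+ 2 - v) / v ^+ 2 +
     2 * (a / (1 + prec j' * Q)) * drift (noise_of z) k.+1 j' * noise_of z k / v)
  else 0.

Lemma measurable_drift_mart k j : measurable_fun setT (fun z => drift_mart z k j).
Proof.
elim: j k => [|j IH] k /=; first exact: measurable_cst.
apply: measurable_funD => //; apply: measurable_funD.
  by apply: measurable_funM => //; apply: measurable_funB => //; exact: measurable_funX.
by apply: measurable_funM => //; apply: measurable_funM => //; exact: measurable_funM.
Qed.

Lemma eq_drift_mart z z' k j : (forall i, (k <= i)%N -> noise_of z i = noise_of z' i) ->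
  drift_mart z k j = drift_mart z' k j.
Proof.
elim: j k => //= j IH k h; rewrite h// (IH k.+1); last by move=> i ki; apply: h; exact: ltnW.
by rewrite (eq_drift _ _ _ (y' := noise_of z'))// => i ki; apply: h; exact: ltnW.
Qed.

(** The new increment has mean zero given the noises after k, so it is orthogonal to the earlier
    sum. Its parts in w^2 - v and in w are orthogonal to each other because the odd Gaussian moments
    vanish. *)
Lemma integral_mart_step k j :
  (\int[P]_t (drift_mart (Y t) k j.+1 ^+ 2)%:E =
   \int[P]_t (drift_mart (Y t) k.+1 j ^+ 2)%:E +
   ((normal_moment4 v - v ^+ 2) / v ^+ 4)%:E + (4 * (a / (1 + prec j * Q)) ^+ 2 / v)%:E *
     \int[P]_t (drift (noise_of (Y t)) k.+1 j ^+ 2)%:E)%E.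
Proof.
have m4 : 0 <= (normal_moment4 v - v ^+ 2) / v ^+ 4.
  have [_ _ hw _] := hS; have [h _] := gauss_quad_sqr (hw 0%N) v0.
  by rewrite divr_ge0 ?subr_ge0// exprn_ge0// ltW.
have p1 := prec_den_gt0 a j v0 Q0.
have b0 : 0 <= 4 * (a / (1 + prec j * Q)) ^+ 2 / v.
  by rewrite divr_ge0 ?(ltW v0)// mulr_ge0 ?sqr_ge0.
transitivity (\int[P]_t (drift_mart (Y t) k.+1 j ^+ 2 + (normal_moment4 v - v ^+ 2) / v ^+ 4 +
   4 * (a / (1 + prec j * Q)) ^+ 2 / v * drift (noise_of (Y t)) k.+1 j ^+ 2)%:E)%E.
  apply: (integral_resample_w (k := k) (f := fun z => drift_mart z k j.+1 ^+ 2)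
    (g := fun z => drift_mart z k.+1 j ^+ 2 + (normal_moment4 v - v ^+ 2) / v ^+ 4 +
   4 * (a / (1 + prec j * Q)) ^+ 2 / v * drift (noise_of z) k.+1 j ^+ 2)).
  - by apply: measurable_funX; exact: measurable_drift_mart.
  - by move=> z; exact: sqr_ge0.
  - apply: measurable_funD; last by apply: measurable_funM => //; exact: measurable_funX.
    by apply: measurable_funD => //; apply: measurable_funX; exact: measurable_drift_mart.
  - by move=> z; rewrite !addr_ge0 ?sqr_ge0// mulr_ge0 ?sqr_ge0.
  move=> z; exists (drift_mart z k.+1 j - v^-1),
    (2 * (a / (1 + prec j * Q)) * drift (noise_of z) k.+1 j / v), (v ^- 2).
  split=> x; have [h1 h2 _ _] := update_w a z k x.
    rewrite /= h2 (eq_drift _ _ _ _ h1) (eq_drift_mart _ h1); congr (_ ^+ 2).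
    by field; rewrite !gt_eqF.
  rewrite (eq_drift _ _ _ _ h1) (eq_drift_mart _ h1).
  by field; rewrite !gt_eqF.
under eq_integral do rewrite !EFinD [X in (_ + X)%E]EFinM.
have m2 : measurable_fun setT (fun t => (drift (noise_of (Y t)) k.+1 j ^+ 2)%:E).
  apply: (mY (f := fun z => (drift (noise_of z) k.+1 j ^+ 2)%:E)).
  by apply/measurable_EFinP; exact: measurable_funX.
have m3 : measurable_fun setT (fun t => (drift_mart (Y t) k.+1 j ^+ 2)%:E).
  apply: (mY (f := fun z => (drift_mart z k.+1 j ^+ 2)%:E)).
  by apply/measurable_EFinP; apply: measurable_funX; exact: measurable_drift_mart.
rewrite ge0_integralD//; first last.
- exact: measurable_funeM.
- by move=> t _; rewrite -EFinM lee_fin mulr_ge0 ?sqr_ge0.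
- exact: emeasurable_funD.
- by move=> t _; rewrite -EFinD lee_fin addr_ge0 ?sqr_ge0.
rewrite ge0_integralD//; first last.
- by move=> t _; rewrite lee_fin sqr_ge0.
rewrite integral_probability_cst ge0_integralZl//.
by move=> t _; rewrite lee_fin sqr_ge0.
Qed.

Lemma integral_mart_sqr (pbar : R) k j : (forall i, prec i <= pbar) ->
  (\int[P]_t (drift_mart (Y t) k j ^+ 2)%:E <=
   (j%:R * ((normal_moment4 v - v ^+ 2) / v ^+ 4 + 4 / v * pbar))%:E)%E.
Proof.
move=> hp; elim: j k => [|j IH] k.
  by under eq_integral do rewrite /= expr0n/=; rewrite integral0 mul0r.
have -> : ((j.+1%:R * ((normal_moment4 v - v ^+ 2) / v ^+ 4 + 4 / v * pbar))%:E =
  (j%:R * ((normal_moment4 v - v ^+ 2) / v ^+ 4 + 4 / v * pbar))%:E +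
  (((normal_moment4 v - v ^+ 2) / v ^+ 4)%:E + (4 / v * pbar)%:E))%E.
  by rewrite -!EFinD -natr1 mulrDl mul1r.
rewrite integral_mart_step -addeA; apply: leeD => //; rewrite leeD2l//.
have p1 := prec_den_gt0 a j v0 Q0.
have D1 : 1 <= 1 + prec j * Q by rewrite lerDl mulr_ge0 ?prec_ge0.
have b1 : (a / (1 + prec j * Q)) ^+ 2 <= 1.
  have /andP[a0 a1] := a01.
  rewrite expr_le1//; first by rewrite ler_pdivrMr// mul1r (le_trans a1).
  by rewrite divr_ge0// ltW.
apply: (@le_trans _ _ ((4 * (a / (1 + prec j * Q)) ^+ 2 / v)%:E * (prec j)%:E)%E).
  rewrite lee_wpmul2l ?integral_drift_sqr// lee_fin divr_ge0 ?(ltW v0)//.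
  by rewrite mulr_ge0 ?sqr_ge0.
rewrite -EFinM lee_fin; apply: ler_pM => //.
- by rewrite divr_ge0 ?(ltW v0)// mulr_ge0 ?sqr_ge0.
- exact: prec_ge0.
- by rewrite ler_pM2r ?invr_gt0// ler_piMr.
Qed.

End concentration.

(** * L^1 bounds for the log-likelihood ratio around its linear trend *)

Section deviation.
Context {R : realType}.
Variables (v Pi0 a : R) (S : gm_system R).
Hypotheses (v0 : 0 < v) (Pi00 : 0 <= Pi0) (a01 : 0 <= a <= 1).
Hypothesis hS : gm_model v Pi0 a S.
Notation Q := (Pi0 * (1 - a ^+ 2)).
Notation P := (gm_P S).
Notation idx := (option (nat + nat)).
Implicit Types z : cylinderType idx R.
Notation Y := (@gm_sample R S).
Notation prec := (prec v a Q).
Notation drift := (drift v a Q).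
Notation offset := (offset v a Q).

Let Q0 : 0 <= Q := process_var_ge0 Pi00 a01.
Let p0 j : 0 <= prec j := prec_ge0 a j v0 Q0.
Let D0 j : 0 < 1 + prec j * Q := prec_den_gt0 a j v0 Q0.

Let mdr2 k j : measurable_fun setT (fun t => drift (noise_of (Y t)) k j ^+ 2).
Proof.
apply: measurable_funX; apply: measurable_drift => i.
exact: (measurable_funPT (gm_w S i)).
Qed.

Let mll n : measurable_fun setT (fun t => log_lr v a Q Pi0 n (noise_of (Y t))).
Proof. by apply: measurable_log_lr => i; exact: (measurable_funPT (gm_w S i)). Qed.

Lemma le_integral_prior_term k j :
  (\int[P]_t (Pi0 / (1 + prec j * Pi0) * drift (noise_of (Y t)) k j ^+ 2)%:E <= 1)%E.
Proof.
have p1 : 0 < 1 + prec j * Pi0 by rewrite ltr_pwDl// mulr_ge0.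
under eq_integral do rewrite EFinM.
rewrite ge0_integralZl//; last 3 first.
- exact/measurable_EFinP.
- by move=> t _; rewrite lee_fin sqr_ge0.
- by rewrite lee_fin divr_ge0// ltW.
apply: (@le_trans _ _ ((Pi0 / (1 + prec j * Pi0))%:E * (prec j)%:E)%E).
  by rewrite lee_wpmul2l ?integral_drift_sqr// lee_fin divr_ge0// ltW.
by rewrite -EFinM lee_fin mulrAC ler_pdivrMr// mul1r mulrC lerDr.
Qed.

Lemma prec_le_linear j : prec j <= j%:R / v.
Proof.
elim: j => [|j IH]; first by rewrite mul0r.
have -> : (j.+1%:R : R) = j%:R + 1 by rewrite natr1.
rewrite /= mulrDl mul1r addrC lerD2r (le_trans _ IH)//.
have /andP[a0 a1] := a01.
apply: (@le_trans _ _ (prec j / (1 + prec j * Q))).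
  by rewrite ler_piMl ?divr_ge0 ?(ltW (D0 j))// expr_le1.
by rewrite ler_pdivrMr// ler_peMr// lerDl mulr_ge0.
Qed.

Lemma ln_le_linear (x eps : R) : 0 <= x -> 0 < eps ->
  exists C, forall n : nat, ln (1 + n%:R * x) <= C + eps * n%:R.
Proof.
move=> x0 e0; pose th := eps / (x + 1).
have th0 : 0 < th by rewrite divr_gt0// ltr_wpDl.
(* From ln (th y) <= th y with y = 1 + n x; the choice of th makes th x at most eps. *)
exists (th - ln th) => n.
have y0 : 0 < 1 + n%:R * x by rewrite ltr_pwDl// mulr_ge0.
have := ln_sublinear (mulr_gt0 th0 y0).
rewrite lnM ?posrE// => h.
have : th * (n%:R * x) <= eps * n%:R.
  by rewrite /th mulrAC ler_pdivrMr ?ltr_wpDl// -mulrA ler_pM2l// mulrDr mulr1 lerDl.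
lra.
Qed.

(** With [Q = 0] every [offset] vanishes. The quadratic term from the initial signal has mean at
    most 1, and the logarithm is at most ln (1 + n Pi0 / v) since [prec] grows at most linearly. *)
Lemma log_lr_deviation0 (eps : R) : Q = 0 -> 0 < eps ->
  exists C, forall n : nat, (0 < n)%N ->
    (\int[P]_t (`|2 * log_lr v a Q Pi0 n (noise_of (Y t))|)%:E <= (C + eps * n%:R)%:E)%E.
Proof.
move=> Q00 e0.
have off0 y k j : offset y k j = 0.
  elim: j k => //= j IH k; rewrite IH Q00 !mulr0 addr0 ln1 mul0r mul0r subrr mul0r.
  by rewrite addr0.
have x0 : 0 <= Pi0 / v by rewrite divr_ge0// ltW.
have [C hC] := ln_le_linear x0 e0.
exists (1 + C) => n _.
have p1 : 1 <= 1 + prec n * Pi0 by rewrite lerDl mulr_ge0.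
have hl : ln (1 + prec n * Pi0) <= C + eps * n%:R.
  apply: le_trans (hC n); rewrite ler_ln ?posrE; last 2 first.
  - exact: lt_le_trans p1.
  - by rewrite ltr_pwDl// mulr_ge0.
  by rewrite lerD2l mulrA mulrAC ler_wpM2r// prec_le_linear.
have hl0 : 0 <= ln (1 + prec n * Pi0) by exact: ln_ge0.
have h0 t : 0 <= Pi0 / (1 + prec n * Pi0) * drift (noise_of (Y t)) 0 n ^+ 2.
  by rewrite mulr_ge0 ?sqr_ge0// divr_ge0// (le_trans ler01 p1).
apply: (@le_trans _ _ (\int[P]_t ((Pi0 / (1 + prec n * Pi0) * drift (noise_of (Y t)) 0 n ^+ 2)%:E
    + (ln (1 + prec n * Pi0))%:E))%E).
  apply: ge0_le_integral => //.
  - apply/measurable_EFinP; apply: measurableT_comp => //; exact: measurable_funM.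
  - by apply: emeasurable_funD => //; apply/measurable_EFinP; exact: measurable_funM.
  move=> t _; rewrite -EFinD lee_fin /log_lr off0 add0r mulrC divfK//.
  by rewrite (le_trans (ler_normB _ _))// !ger0_norm.
rewrite ge0_integralD//; first last.
- by apply/measurable_EFinP; exact: measurable_funM.
- by move=> t _; rewrite lee_fin.
have -> : ((1 + C + eps * n%:R)%:E = 1 + (C + eps * n%:R)%:E)%E by rewrite -EFinD addrA.
apply: leeD; first exact: le_integral_prior_term.
by rewrite integral_probability_cst lee_fin.
Qed.

Section stationary.
Variable pbar : R.
Hypothesis pbarE : pbar = v^-1 + a ^+ 2 * (pbar / (1 + pbar * Q)).
Hypothesis pbar0 : 0 <= pbar.
Hypothesis a1 : a < 1.

Let Db0 : 0 < 1 + pbar * Q.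
Proof. by rewrite ltr_pwDl// mulr_ge0. Qed.

(** Subtracting the fixed-point equation shows that the Riccati step keeps the sign of the error and
    multiplies it by at most a^2. Starting from 0, [prec] thus stays below [pbar] and approaches it
    geometrically. *)
Let precB j : prec j.+1 - pbar =
  a ^+ 2 * (prec j - pbar) / ((1 + prec j * Q) * (1 + pbar * Q)).
Proof. by rewrite [X in _ - X]pbarE /=; field; rewrite !gt_eqF. Qed.

Lemma prec_le_pbar j : prec j <= pbar.
Proof.
elim: j => // j IH; rewrite -subr_le0 precB.
rewrite pmulr_lle0 ?invr_gt0 ?mulr_gt0//.
by rewrite mulr_ge0_le0 ?sqr_ge0// subr_le0.
Qed.

Lemma prec_close j : pbar - prec j <= (a ^+ 2) ^+ j * pbar.
Proof.
elim: j => [|j IH]; first by rewrite subr0 expr0 mul1r.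
rewrite -opprB precB -mulNr -mulrN opprB [in leRHS](exprS (a ^+ 2) j) -[leRHS]mulrA.
apply: (@le_trans _ _ (a ^+ 2 * (pbar - prec j))); last by rewrite ler_wpM2l ?sqr_ge0.
have h0 : 0 <= a ^+ 2 * (pbar - prec j) by rewrite mulr_ge0 ?sqr_ge0// subr_ge0 prec_le_pbar.
rewrite ler_pdivrMr ?mulr_gt0// ler_peMr//.
by rewrite mulr_ege1// lerDl mulr_ge0.
Qed.

(* With [g] and [b] the limits of [Q / (1 + prec j * Q)] and of the factor
   [a / (1 + prec j * Q)] in [drift], the coefficient [c = g / (1 - b ^ 2)] makes
   the increments of [2 * offset + c * drift ^ 2] equal to the constant
   [- lim_rate] plus [c] times martingale increments, up to errors that are
   controlled by [pbar - prec j] and hence summable. *)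
Definition lim_coef := Q / (1 + pbar * Q) / (1 - (a / (1 + pbar * Q)) ^+ 2).
Definition lim_rate := ln (1 + pbar * Q) - lim_coef / v.

Let Db1 : 1 <= 1 + pbar * Q. Proof. by rewrite lerDl mulr_ge0. Qed.

Let bb1 : (a / (1 + pbar * Q)) ^+ 2 < 1.
Proof.
have /andP[a0 _] := a01.
rewrite expr_lt1//; first by rewrite ltr_pdivrMr// mul1r (lt_le_trans a1).
by rewrite divr_ge0// ltW.
Qed.

Let c0 : 0 <= lim_coef.
Proof. by rewrite divr_ge0 ?subr_ge0 ?(ltW bb1)// divr_ge0// ltW. Qed.

Definition quad_err j := (Q / (1 + prec j * Q) - Q / (1 + pbar * Q)) +
  lim_coef * ((a / (1 + prec j * Q)) ^+ 2 - (a / (1 + pbar * Q)) ^+ 2).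
Definition log_err j := ln (1 + pbar * Q) - ln (1 + prec j * Q).

Fixpoint remainder z k j : R :=
  if j is j'.+1 then remainder z k.+1 j' +
    (`|quad_err j'| * drift (noise_of z) k.+1 j' ^+ 2 + `|log_err j'|) else 0.

Lemma le_quad_err j : `|quad_err j| <= (Q ^+ 2 + 2 * lim_coef * Q) * (pbar - prec j).
Proof.
have /andP[a0 _] := a01.
have d0 : 0 <= pbar - prec j by rewrite subr_ge0 prec_le_pbar.
have D1 : 1 <= 1 + prec j * Q by rewrite lerDl mulr_ge0.
have DD : 1 <= (1 + prec j * Q) * (1 + pbar * Q) by rewrite mulr_ege1.
have DD0 : 0 < (1 + prec j * Q) * (1 + pbar * Q) by rewrite mulr_gt0.
have E1 : Q / (1 + prec j * Q) - Q / (1 + pbar * Q) =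
    Q ^+ 2 * (pbar - prec j) / ((1 + prec j * Q) * (1 + pbar * Q)).
  by field; rewrite !gt_eqF.
have E2 : (a / (1 + prec j * Q)) ^+ 2 - (a / (1 + pbar * Q)) ^+ 2 =
    a * (Q * (pbar - prec j)) / ((1 + prec j * Q) * (1 + pbar * Q)) *
    (a / (1 + prec j * Q) + a / (1 + pbar * Q)).
  by field; rewrite !gt_eqF.
have h1 : 0 <= Q ^+ 2 * (pbar - prec j) by rewrite mulr_ge0 ?sqr_ge0.
have h2 : 0 <= a * (Q * (pbar - prec j)) by rewrite mulr_ge0// mulr_ge0.
have h3 : 0 <= a / (1 + prec j * Q) + a / (1 + pbar * Q).
  by rewrite addr_ge0// divr_ge0// ltW.
have h4 : a / (1 + prec j * Q) + a / (1 + pbar * Q) <= 2.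
  have q1 : a / (1 + prec j * Q) <= 1 by rewrite ler_pdivrMr// mul1r (le_trans (ltW a1)).
  have q2 : a / (1 + pbar * Q) <= 1 by rewrite ler_pdivrMr// mul1r (le_trans (ltW a1)).
  lra.
rewrite /quad_err E1 E2 ger0_norm; last first.
  apply: addr_ge0; first by rewrite divr_ge0// ltW.
  by rewrite mulr_ge0// mulr_ge0// divr_ge0// ltW.
rewrite [leRHS]mulrDl lerD//.
  by rewrite ler_pdivrMr// ler_peMr.
have h5 : a * (Q * (pbar - prec j)) / ((1 + prec j * Q) * (1 + pbar * Q)) <=
    Q * (pbar - prec j).
  have Qd : 0 <= Q * (pbar - prec j) by rewrite mulr_ge0.
  rewrite ler_pdivrMr//; apply: (@le_trans _ _ (Q * (pbar - prec j))).
    by rewrite ler_piMl// ltW.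
  by rewrite ler_peMr.
have -> : 2 * lim_coef * Q * (pbar - prec j) = lim_coef * (Q * (pbar - prec j) * 2).
  by move: lim_coef => c; ring.
by rewrite ler_wpM2l//; apply: ler_pM => //; rewrite divr_ge0// ltW.
Qed.

Lemma le_log_err j : `|log_err j| <= Q * (pbar - prec j).
Proof.
have d0 : 0 <= pbar - prec j by rewrite subr_ge0 prec_le_pbar.
have D1 : 1 <= 1 + prec j * Q by rewrite lerDl mulr_ge0.
rewrite /log_err -ln_div ?posrE// ger0_norm; last first.
  by rewrite ln_ge0// ler_pdivlMr// mul1r lerD2l ler_wpM2r// prec_le_pbar.
have h : ln ((1 + pbar * Q) / (1 + prec j * Q)) <= (1 + pbar * Q) / (1 + prec j * Q) - 1.
  have hr := divr_gt0 Db0 (D0 j).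
  rewrite -ler_expR lnK ?posrE//.
  set x := (1 + pbar * Q) / (1 + prec j * Q); have := expR_ge1Dx (x - 1); lra.
have : (1 + pbar * Q) / (1 + prec j * Q) - 1 <= Q * (pbar - prec j).
  have -> : (1 + pbar * Q) / (1 + prec j * Q) - 1 = Q * (pbar - prec j) / (1 + prec j * Q).
    by field; rewrite gt_eqF.
  by rewrite ler_pdivrMr// ler_peMr// mulr_ge0.
lra.
Qed.

(** In one step the square of [drift] leaves g_j + c b_j^2 - c as the coefficient of the previous
    square, where g_j = Q / (1 + prec j * Q) and b_j = a / (1 + prec j * Q). The choice of c makes
    the limit of this coefficient zero, and [quad_err j] is exactly what is left; [log_err j] plays
    the same part for the logarithms. *)
Lemma offset_dev z k j :
  `|2 * offset (noise_of z) k j + lim_coef * drift (noise_of z) k j ^+ 2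
    + lim_rate * j%:R - lim_coef * drift_mart v Pi0 a z k j| <= remainder z k j.
Proof.
elim: j k => [|j IH] k.
  by rewrite /= expr0n/= !mulr0 !addr0 subr0 normr0.
have -> : (j.+1%:R : R) = j%:R + 1 by rewrite natr1.
rewrite [remainder _ _ _]/=.
have -> : 2 * offset (noise_of z) k j.+1 + lim_coef * drift (noise_of z) k j.+1 ^+ 2
    + lim_rate * (j%:R + 1) - lim_coef * drift_mart v Pi0 a z k j.+1 =
  (2 * offset (noise_of z) k.+1 j + lim_coef * drift (noise_of z) k.+1 j ^+ 2
    + lim_rate * j%:R - lim_coef * drift_mart v Pi0 a z k.+1 j) +
  (quad_err j * drift (noise_of z) k.+1 j ^+ 2 + log_err j).
  rewrite /= /lim_rate /quad_err /log_err.
  have -> : Q / (1 + pbar * Q) = lim_coef * (1 - (a / (1 + pbar * Q)) ^+ 2).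
    by rewrite /lim_coef divfK// gt_eqF// subr_gt0.
  move: lim_coef (ln _) (ln _) => c L1 L2.
  by field; rewrite !gt_eqF.
apply: (le_trans (ler_normD _ _)); apply: lerD; first exact: IH.
apply: (le_trans (ler_normD _ _)); rewrite lerD2r normrM.
by rewrite [X in _ * X]ger0_norm ?sqr_ge0.
Qed.

Let mrem k j : measurable_fun setT (fun t => remainder (Y t) k j).
Proof.
elim: j k => [|j IH] k /=; first exact: measurable_cst.
by apply: measurable_funD => //; apply: measurable_funD => //; exact: measurable_funM.
Qed.

Lemma remainder_ge0 z k j : 0 <= remainder z k j.
Proof. by elim: j k => //= j IH k; rewrite !addr_ge0// mulr_ge0 ?sqr_ge0. Qed.

(** Sum of a geometric series of ratio a^2. In the first summand one factor [pbar] comes from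
    [prec_close], the other from the second moment of [drift]. *)
Definition remainder_bound :=
  ((Q ^+ 2 + 2 * lim_coef * Q) * pbar + Q) * pbar / (1 - a ^+ 2).

Lemma integral_remainder k j : (\int[P]_t (remainder (Y t) k j)%:E <=
  (remainder_bound * (1 - (a ^+ 2) ^+ j))%:E)%E.
Proof.
have /andP[a0 _] := a01.
have a21 : 0 < 1 - a ^+ 2 by rewrite subr_gt0 expr_lt1.
elim: j k => [|j IH] k.
  by under eq_integral do rewrite /=; rewrite integral0 expr0 subrr mulr0.
have -> : remainder_bound * (1 - (a ^+ 2) ^+ j.+1) =
  remainder_bound * (1 - (a ^+ 2) ^+ j) +
  ((Q ^+ 2 + 2 * lim_coef * Q) * ((a ^+ 2) ^+ j * pbar) * pbar +
   Q * ((a ^+ 2) ^+ j * pbar)).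
  rewrite /remainder_bound (exprS (a ^+ 2) j); move: lim_coef => c.
  by field; rewrite gt_eqF.
rewrite EFinD.
have m1 : measurable_fun setT (fun t => `|quad_err j| * drift (noise_of (Y t)) k.+1 j ^+ 2).
  exact: measurable_funM.
have n1 t : 0 <= `|quad_err j| * drift (noise_of (Y t)) k.+1 j ^+ 2.
  by rewrite mulr_ge0 ?sqr_ge0.
under eq_integral do rewrite /= EFinD EFinD.
rewrite ge0_integralD//; first last.
- by apply: emeasurable_funD => //; exact/measurable_EFinP.
- by move=> t _; rewrite -EFinD lee_fin addr_ge0.
- exact/measurable_EFinP.
- by move=> t _; rewrite lee_fin remainder_ge0.
apply: leeD; first exact: IH.
rewrite ge0_integralD//; first last.
- exact/measurable_EFinP.
- by move=> t _; rewrite lee_fin.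
rewrite integral_probability_cst EFinD; apply: leeD; last first.
  by rewrite lee_fin (le_trans (le_log_err j))// ler_wpM2l// prec_close.
under eq_integral do rewrite EFinM.
rewrite ge0_integralZl//; last 2 first.
- exact/measurable_EFinP.
- by move=> t _; rewrite lee_fin sqr_ge0.
apply: (@le_trans _ _ ((`|quad_err j|)%:E * (prec j)%:E)%E).
  by rewrite lee_wpmul2l ?integral_drift_sqr// lee_fin.
rewrite -EFinM lee_fin; apply: ler_pM => //; last exact: prec_le_pbar.
rewrite (le_trans (le_quad_err j))// ler_wpM2l ?prec_close// addr_ge0 ?sqr_ge0//.
by rewrite mulr_ge0// mulr_ge0.
Qed.

Let mmart n : measurable_fun setT (fun t => drift_mart v Pi0 a (Y t) 0 n ^+ 2).
Proof.
have ms : measurable_fun setT Y by exact: measurable_sample.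
have mz : measurable_fun setT (fun z => drift_mart v Pi0 a z 0 n ^+ 2).
  by apply: measurable_funX; exact: measurable_drift_mart.
exact: (measurableT_comp mz ms).
Qed.

(** All terms but the martingale are bounded in L^1 uniformly in n. The martingale W has second
    moment at most n M, and |W| <= W^2 / tau + tau with tau = dl n bounds its mean absolute value by
    M / dl + dl n; [dl] is chosen so that lim_coef dl <= eps. *)
Lemma log_lr_deviation_stationary (eps : R) : 0 < eps ->
  exists C, forall n : nat, (0 < n)%N ->
    (\int[P]_t (`|2 * log_lr v a Q Pi0 n (noise_of (Y t)) + lim_rate * n%:R|)%:E
      <= (C + eps * n%:R)%:E)%E.
Proof.
move=> e0; have /andP[a0 _] := a01.
pose M := (normal_moment4 v - v ^+ 2) / v ^+ 4 + 4 / v * pbar.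
pose dl := eps / (lim_coef + 1).
have c1 : 0 < lim_coef + 1 by rewrite ltr_wpDl.
have dl0 : 0 < dl by rewrite divr_gt0.
pose Lp := ln (1 + pbar * Pi0).
have rb0 : 0 <= remainder_bound.
  rewrite /remainder_bound divr_ge0//; last by rewrite subr_ge0 expr_le1// ltW.
  rewrite mulr_ge0// addr_ge0// mulr_ge0// addr_ge0 ?sqr_ge0//.
  by rewrite mulr_ge0// mulr_ge0.
exists (remainder_bound + (lim_coef * pbar + (lim_coef * (M / dl) + (1 + Lp)))) => n n0.
have nR : 0 < (n%:R : R) by rewrite ltr0n.
have tau0 : 0 < dl * n%:R by rewrite mulr_gt0.
have p1 : 1 <= 1 + prec n * Pi0 by rewrite lerDl mulr_ge0.
have pL : 0 <= ln (1 + prec n * Pi0) <= Lp.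
  rewrite ln_ge0// ler_ln ?posrE ?(lt_le_trans ltr01 p1)//; last first.
    by rewrite ltr_pwDl// mulr_ge0.
  by rewrite lerD2l ler_wpM2r// prec_le_pbar.
pose f1 t := remainder (Y t) 0 n.
pose f2 t := lim_coef * drift (noise_of (Y t)) 0 n ^+ 2.
pose f3 t := (lim_coef / (dl * n%:R)) * drift_mart v Pi0 a (Y t) 0 n ^+ 2.
pose f4 t := Pi0 / (1 + prec n * Pi0) * drift (noise_of (Y t)) 0 n ^+ 2.
pose f5 := Lp + lim_coef * (dl * n%:R).
have f1_ge0 t : 0 <= f1 t by exact: remainder_ge0.
have f2_ge0 t : 0 <= f2 t by rewrite mulr_ge0 ?sqr_ge0.
have f3_ge0 t : 0 <= f3 t by rewrite mulr_ge0 ?sqr_ge0// divr_ge0// ltW.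
have f4_ge0 t : 0 <= f4 t by rewrite mulr_ge0 ?sqr_ge0// divr_ge0// (le_trans ler01 p1).
have f5_ge0 : 0 <= f5.
  have Lp0 : 0 <= Lp by case/andP: pL => /le_trans; apply.
  by rewrite addr_ge0// mulr_ge0// ltW.
have mf1 : measurable_fun setT (fun t => (f1 t)%:E).
  by apply/measurable_EFinP; exact: mrem.
have mf2 : measurable_fun setT (fun t => (f2 t)%:E).
  by apply/measurable_EFinP; exact: measurable_funM.
have mf3 : measurable_fun setT (fun t => (f3 t)%:E).
  by apply/measurable_EFinP; exact: measurable_funM.
have mf4 : measurable_fun setT (fun t => (f4 t)%:E).
  by apply/measurable_EFinP; exact: measurable_funM.
apply: (@le_trans _ _ (\int[P]_t ((f1 t)%:E + ((f2 t)%:E + ((f3 t)%:E + ((f4 t)%:E + f5%:E)))))%E).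
  apply: ge0_le_integral => //.
  - apply/measurable_EFinP; apply: measurableT_comp => //.
    by apply: measurable_funD => //; exact: measurable_funM.
  - by do 4 apply: emeasurable_funD => //.
  move=> t _; rewrite -!EFinD lee_fin.
  have := offset_dev (Y t) 0 n; rewrite -/(f1 t).
  rewrite /log_lr -/(f4 t).
  set off := offset _ _ _; set W := drift_mart _ _ _ _ _ _; set q := drift _ _ _.
  move=> h.
  have hW : lim_coef * `|W| <= f3 t + lim_coef * (dl * n%:R).
    have -> : f3 t + lim_coef * (dl * n%:R) =
      lim_coef * (W ^+ 2 / (dl * n%:R) + dl * n%:R).
      by rewrite /f3 -/W; field; rewrite !gt_eqF.
    rewrite ler_wpM2l// -real_normK ?num_real//.
    move: `|W| (normr_ge0 W) (dl * n%:R) tau0 => w w0 tau tau0'.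
    rewrite -subr_ge0; have -> : w ^+ 2 / tau + tau - w = ((w - tau) ^+ 2 + w * tau) / tau.
      by field; rewrite gt_eqF.
    by rewrite divr_ge0 ?(ltW tau0')// addr_ge0 ?sqr_ge0// mulr_ge0// ltW.
  have -> : 2 * (off + (f4 t - ln (1 + prec n * Pi0)) / 2) + lim_rate * n%:R =
    (2 * off + lim_coef * q ^+ 2 + lim_rate * n%:R - lim_coef * W) +
    (- f2 t + (lim_coef * W + (f4 t - ln (1 + prec n * Pi0)))).
    by rewrite /f2 -/q; field.
  apply: (le_trans (ler_normD _ _)); apply: lerD => //.
  apply: (le_trans (ler_normD _ _)); rewrite normrN ger0_norm// lerD2l.
  apply: (le_trans (ler_normD _ _)); rewrite normrM (ger0_norm c0).
  have : `|f4 t - ln (1 + prec n * Pi0)| <= f4 t + Lp.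
    by case/andP: pL => l0 l1; rewrite ler_norml; have := f4_ge0 t; lra.
  by move: hW; rewrite /f5; lra.
rewrite ge0_integralD//; try by
  [do 3 apply: emeasurable_funD => //|move=> t _; rewrite ?adde_ge0 ?lee_fin].
have -> : ((remainder_bound + (lim_coef * pbar + (lim_coef * (M / dl) + (1 + Lp))) + eps * n%:R)%:E
  = remainder_bound%:E + ((lim_coef * pbar)%:E + ((lim_coef * (M / dl))%:E +
     (1 + (Lp + eps * n%:R)%:E))))%E.
  rewrite -!EFinD; congr (_%:E); move: lim_coef remainder_bound => c rb.
  by rewrite -!addrA.
apply: leeD.
  apply: (le_trans (integral_remainder 0 n)); rewrite lee_fin ler_piMr//.
  by rewrite gerBl exprn_ge0 ?sqr_ge0.
rewrite ge0_integralD//; try by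
  [do 2 apply: emeasurable_funD => //|move=> t _; rewrite ?adde_ge0 ?lee_fin].
apply: leeD.
  rewrite /f2; under eq_integral do rewrite EFinM.
  rewrite ge0_integralZl//; last 2 first.
  - exact/measurable_EFinP.
  - by move=> t _; rewrite lee_fin sqr_ge0.
  rewrite [leRHS]EFinM lee_wpmul2l//.
  by apply: (le_trans (integral_drift_sqr v0 Pi00 a01 hS 0 n)); rewrite lee_fin prec_le_pbar.
rewrite ge0_integralD//; try by
  [apply: emeasurable_funD => //|move=> t _; rewrite ?adde_ge0 ?lee_fin].
apply: leeD.
  rewrite /f3; under eq_integral do rewrite EFinM.
  rewrite ge0_integralZl//; last 3 first.
  - exact/measurable_EFinP.
  - by move=> t _; rewrite lee_fin sqr_ge0.
  - by rewrite lee_fin divr_ge0// ltW.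
  have -> : lim_coef * (M / dl) = lim_coef / (dl * n%:R) * (n%:R * M).
    by field; rewrite !gt_eqF.
  rewrite [leRHS]EFinM lee_wpmul2l//; first by rewrite lee_fin divr_ge0// ltW.
  exact: (integral_mart_sqr v0 Pi00 a01 hS 0 n prec_le_pbar).
rewrite ge0_integralD//; try by [move=> t _; rewrite lee_fin].
apply: leeD; first exact: le_integral_prior_term.
rewrite integral_probability_cst lee_fin /f5 lerD2l mulrA ler_wpM2r//.
by rewrite /dl mulrA ler_pdivrMr// mulrC ler_pM2l// lerDl.
Qed.

End stationary.
End deviation.

(** * Stein's lemma *)

Section stein.
Context {R : realType}.
Variables (v Pi0 a : R) (S : gm_system R).
Hypotheses (v0 : 0 < v) (Pi00 : 0 <= Pi0) (a01 : 0 <= a <= 1).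
Hypothesis hS : gm_model v Pi0 a S.
Notation Q := (Pi0 * (1 - a ^+ 2)).
Notation P := (gm_P S).
Notation Y := (@gm_sample R S).
Variable kappa : R.

Let W n t := log_lr v a Q Pi0 n (noise_of (Y t)).

Let mW n : measurable_fun setT (W n).
Proof. by apply: measurable_log_lr => i; exact: (measurable_funPT (gm_w S i)). Qed.

(** A detector has to be a region of observations, so the likelihood ratio is needed as a function
    of the tuple. The padding by 0 is harmless: [log_lr] reads the first n entries only. *)
Let Wobs n (y : n.-tuple R) := log_lr v a Q Pi0 n (fun i => nth 0 y i).

Let WobsE n t : Wobs (@obs_H0 R S n t) = W n t.
Proof.
apply: eq_log_lr => i ilt; rewrite -(tnth_nth 0 _ (Ordinal ilt)) tnth_mktuple.
by [].
Qed.

Let mWobs n : measurable_fun setT (@Wobs n).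
Proof.
apply: measurable_log_lr => i.
have [ilt|ige] := ltnP i n.
  rewrite (_ : (fun _ => _) = fun y : n.-tuple R => tnth y (Ordinal ilt)); last first.
    by apply/funext => y; rewrite (tnth_nth 0).
  exact: measurable_tnth.
rewrite (_ : (fun _ => _) = fun y : n.-tuple R => 0); first exact: measurable_cst.
by apply/funext => y; rewrite nth_default// size_tuple.
Qed.

Let mobs0 n : measurable_fun setT (@obs_H0 R S n).
Proof.
apply/measurable_fun_tnthP => i.
rewrite (_ : _ \o _ = gm_w S i); first exact: measurable_funPT.
by apply/funext => t; rewrite /= tnth_mktuple.
Qed.

Let mindic n (D : set (n.-tuple R)) : measurable D ->
  measurable_fun setT (fun t => \1_(~` D) (@obs_H0 R S n t) : R).
Proof.
move=> mD.
have mi : measurable_fun setT (\1_(~` D) : n.-tuple R -> R).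
  exact: (measurable_indic (measurableC mD)).
exact: (measurableT_comp mi (@mobs0 n)).
Qed.

Lemma missE n (D : set (n.-tuple R)) : measurable D ->
  (miss a S D = \int[P]_t (\1_(~` D) (@obs_H0 R S n t) * expR (W n t))%:E)%E.
Proof.
by move=> mD; rewrite /miss (prob_obs_H1 v0 Pi00 a01 hS (measurableC mD)).
Qed.

Hypothesis deviation : forall eps : R, 0 < eps -> exists C, forall n : nat, (0 < n)%N ->
  (\int[P]_t (`|2 * W n t + 2 * kappa * n%:R|)%:E <= (C + eps * n%:R)%:E)%E.

Let bad (e : R) n := [set t | e * n%:R <= `|2 * W n t + 2 * kappa * n%:R| ].

Let mdev n : measurable_fun setT (fun t => `|2 * W n t + 2 * kappa * n%:R|).
Proof.
apply: measurableT_comp => //; apply: measurable_funD => //.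
exact: measurable_funM.
Qed.

Let mbad e n : measurable (bad e n).
Proof.
rewrite /bad -[X in measurable X]setTI.
rewrite (_ : [set t | _] = (fun t => `|2 * W n t + 2 * kappa * n%:R|) @^-1` `[e * n%:R, +oo[).
  exact: mdev.
by apply/seteqP; split=> t /=; rewrite in_itv/= andbT.
Qed.

Lemma bad_small (e th : R) : 0 < e -> 0 < th ->
  exists N : nat, forall n, (N <= n)%N -> (P (bad e n) <= th%:E)%E.
Proof.
move=> e0 th0.
have eps0 : 0 < e * th / 2 by rewrite divr_gt0// mulr_gt0.
have [C hC] := deviation eps0.
(* For n at least x, the constant C is absorbed by the other half of e th n in Markov's
   inequality. *)
pose x := `|C| * 2 / (e * th).
exists (Num.truncn x).+1 => n Nn.
have n0 : (0 < n)%N by exact: leq_trans Nn.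
have nR : 0 < (n%:R : R) by rewrite ltr0n.
have xn : x <= n%:R.
  by apply/ltW/(lt_le_trans (truncnS_gt x)); rewrite ler_nat.
have Cn : C <= e * th / 2 * n%:R.
  apply: (le_trans (ler_norm C)).
  move: xn; rewrite /x ler_pdivrMr ?mulr_gt0// => h; lra.
have H : ((e * n%:R)%:E * P (bad e n) <= \int[P]_t (`|2 * W n t + 2 * kappa * n%:R|)%:E)%E.
  rewrite -(setIT (bad e n)) -integral_indic// -ge0_integralZl//; last 2 first.
  - by apply/measurable_EFinP; exact: measurable_indic.
  - by rewrite lee_fin mulr_ge0 ?ltW.
  apply: ge0_le_integral => //.
  - by move=> t _; rewrite -EFinM lee_fin mulr_ge0// mulr_ge0 ?ltW.
  - by apply: measurable_funeM; apply/measurable_EFinP; exact: measurable_indic.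
  - exact/measurable_EFinP.
  move=> t _; rewrite -EFinM lee_fin indicE.
  case: (boolP (t \in bad e n)) => ht; last by rewrite mulr0.
  by rewrite mulr1; move: ht; rewrite inE.
have en0 : 0 < e * n%:R by rewrite mulr_gt0.
have : ((e * n%:R)%:E * P (bad e n) <= (e * n%:R * th)%:E)%E.
  apply: (le_trans H); apply: (le_trans (hC n n0)); rewrite lee_fin; lra.
by rewrite [X in (_ <= X)%E -> _]EFinM lee_pmul2l.
Qed.

Variable alpha : R.
Hypothesis alpha01 : 0 < alpha < 1.

Let feasible n := [set D : set (n.-tuple R) |
  measurable D /\ (false_alarm S D <= alpha%:E)%E].

(** Off [bad e n] the likelihood ratio is within a factor exp (e n / 2) of exp (- kappa n). A
    threshold test attains the upper bound. For the lower bound, any admissible miss region has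
    noise probability at least 1 - alpha, and most of it lies where the ratio is not too small. *)
Lemma NP_miss_bounds (e : R) : 0 < e -> exists N : nat, forall n, (N <= n)%N ->
  (1 - alpha) / 2 * expR (- (kappa + e / 2) * n%:R) <= NP_miss a S alpha n
    <= expR (- (kappa - e / 2) * n%:R).
Proof.
move=> e0; have /andP[al0 al1] := alpha01.
(* The bound alpha makes the threshold test admissible; the bound (1 - alpha) / 2 leaves half of 1 -
   alpha for the converse. *)
pose th := Num.min alpha ((1 - alpha) / 2).
have th0 : 0 < th by rewrite lt_min al0 divr_gt0// subr_gt0.
have th1 : th <= alpha by rewrite ge_min lexx.
have th2 : th <= (1 - alpha) / 2 by rewrite ge_min lexx orbT.
have [N hN] := bad_small e0 th0; exists N => n /hN Pbad.
pose F := [set miss a S D | D in @feasible n].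
have inf_le : (ereal_inf F <= (expR (- (kappa - e / 2) * n%:R))%:E)%E.
  pose D := [set y : n.-tuple R | - (kappa - e / 2) * n%:R <= Wobs y].
  have mD : measurable D.
    rewrite -[X in measurable X]setTI.
    rewrite (_ : D = @Wobs n @^-1` `[- (kappa - e / 2) * n%:R, +oo[); first exact: mWobs.
    by apply/seteqP; split=> t /=; rewrite in_itv/= andbT.
  apply: (@le_trans _ _ (miss a S D)).
    apply: ereal_inf_lbound; exists D => //; split => //.
    apply: (@le_trans _ _ (P (bad e n))); last by rewrite (le_trans Pbad)// lee_fin.
    apply: le_measure; rewrite ?inE//.
      by rewrite -[X in measurable X]setTI; exact: mobs0.
    move=> t /=; rewrite /D /bad /= WobsE => h.
    by apply: le_trans (ler_norm _); lra.
  rewrite missE//.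
  rewrite -[leRHS](integral_probability_cst P).
  apply: ge0_le_integral => //.
  - apply/measurable_EFinP; apply: measurable_funM.
      exact: mindic.
    exact: measurableT_comp.
  move=> t _; rewrite lee_fin indicE; case: (boolP (_ \in _)) => ht; last first.
    by rewrite mul0r expR_ge0.
  rewrite mul1r ler_expR; move: ht; rewrite inE /D /= WobsE => /negP.
  by rewrite -ltNge => /ltW.
have inf_ge : (((1 - alpha) / 2 * expR (- (kappa + e / 2) * n%:R))%:E <= ereal_inf F)%E.
  apply: le_ereal_inf_tmp => _ [D [mD fD] <-]; rewrite missE//.
  (* Typical noise on which the detector accepts the noise hypothesis: the complement has
     probability at most alpha + (1 - alpha) / 2. *)
  pose A := (@obs_H0 R S n @^-1` ~` D) `&` ~` bad e n.
  have mO : measurable (@obs_H0 R S n @^-1` D).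
    by rewrite -[X in measurable X]setTI; exact: mobs0.
  have mA : measurable A.
    apply: measurableI; last exact: measurableC.
    by rewrite -preimage_setC; exact: measurableC.
  have PA : (((1 - alpha) / 2)%:E <= P A)%E.
    have -> : A = ~` ((@obs_H0 R S n @^-1` D) `|` bad e n).
      by rewrite /A setCU preimage_setC.
    rewrite probability_setC; last exact: measurableU.
    have : (P (@obs_H0 R S n @^-1` D `|` bad e n) <= (alpha + (1 - alpha) / 2)%:E)%E.
      apply: (le_trans (measureU2 _ _ _)) => //.
      rewrite EFinD; apply: leeD => //.
      by apply: (le_trans Pbad); rewrite lee_fin.
    have : P (@obs_H0 R S n @^-1` D `|` bad e n) \is a fin_num.
      by apply: fin_num_measure; exact: measurableU.
    case: (P _) => // r _; rewrite lee_fin => hr; rewrite -EFinB lee_fin; lra.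
  rewrite mulrC EFinM.
  apply: (@le_trans _ _ ((expR (- (kappa + e / 2) * n%:R))%:E * P A)%E).
    by rewrite lee_wpmul2l// lee_fin expR_ge0.
  rewrite -(setIT A) -integral_indic// -ge0_integralZl//; last first.
    by apply/measurable_EFinP; exact: measurable_indic.
  apply: ge0_le_integral => //.
  - by apply: measurable_funeM; apply/measurable_EFinP; exact: measurable_indic.
  - apply/measurable_EFinP; apply: measurable_funM.
      exact: mindic.
    exact: measurableT_comp.
  move=> t _; rewrite -EFinM lee_fin !indicE.
  case: (boolP (t \in A)) => ht; last by rewrite mulr0 mulr_ge0 ?expR_ge0.
  move: ht; rewrite inE => -[/= tD /= /negP]; rewrite -ltNge => tb.
  have -> : (@obs_H0 R S n t \in ~` D) = true by exact: mem_set.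
  rewrite mulr1 mul1r.
  rewrite ler_expR; have := ler_norm (- (2 * W n t + 2 * kappa * n%:R)).
  by rewrite normrN; lra.
have Ffin : ereal_inf F \is a fin_num.
  rewrite fin_numE -ltey -ltNye.
  by rewrite (lt_le_trans _ inf_ge) ?ltNyr// (le_lt_trans inf_le) ?ltry.
by apply/andP; split; rewrite -lee_fin /NP_miss fineK.
Qed.

Lemma error_exponent_stein : error_exponent a S alpha = kappa.
Proof.
apply/cvg_lim => //; apply/cvgrPdist_le => e e0.
have /andP[al0 al1] := alpha01.
have [N hN] := NP_miss_bounds e0.
pose c := (1 - alpha) / 2.
have c0 : 0 < c by rewrite divr_gt0// subr_gt0.
pose x := 2 * `|ln c| / e.
near=> n.
have Nn : (N <= n)%N by near: n; exact: nbhs_infty_ge.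
have xn : x <= n%:R.
  apply/ltW/(lt_le_trans (truncnS_gt x)); rewrite ler_nat.
  by near: n; exact: nbhs_infty_ge.
have n0 : (0 < n)%N by near: n; exact: nbhs_infty_gt.
have nR : 0 < (n%:R : R) by rewrite ltr0n.
have /andP[lo hi] := hN n Nn.
have m0 : 0 < NP_miss a S alpha n by apply: lt_le_trans lo; rewrite mulr_gt0 ?expR_gt0.
have hi' : ln (NP_miss a S alpha n) <= - (kappa - e / 2) * n%:R.
  by rewrite -ler_expR lnK.
have lo' : ln c + - (kappa + e / 2) * n%:R <= ln (NP_miss a S alpha n).
  by rewrite -ler_expR lnK// expRD lnK.
have lc : - ln c <= e / 2 * n%:R.
  have : - ln c <= `|ln c| by rewrite -normrN ler_norm.
  move: xn; rewrite /x ler_pdivrMr// => h1 h2; lra.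
move: (ln (NP_miss _ _ _ _)) hi' lo' => l hi' lo'.
have -> : kappa - - (n%:R^-1 * l) = (kappa * n%:R + l) / n%:R.
  by field; rewrite gt_eqF.
rewrite normrM normfV (gtr0_norm nR) ler_pdivrMr// ler_norml; apply/andP; split; nra.
Unshelve. all: by end_near.
Qed.

End stein.

(** * The exponent as a function of the correlation *)

Section prediction_gain.
Context {R : rcfType}.
Implicit Types G e y : R.

(* With [e = 1 - a ^ 2] and SNR [G], the ratio P / sigma ^ 2. *)
Definition gain G e :=
  (Num.sqrt ((e - G * e) ^+ 2 + 4 * (G * e)) - e + G * e) / 2.

Lemma gain_eq G e : 0 <= G -> 0 <= e ->
  gain G e ^+ 2 + (e - G * e) * gain G e = G * e.
Proof.
move=> G0 e0; rewrite /gain; set D := Num.sqrt _.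
have D2 : D ^+ 2 = (e - G * e) ^+ 2 + 4 * (G * e).
  by rewrite sqr_sqrtr// addr_ge0 ?sqr_ge0// !mulr_ge0.
have -> : ((D - e + G * e) / 2) ^+ 2 + (e - G * e) * ((D - e + G * e) / 2) =
  (D ^+ 2 - (e - G * e) ^+ 2) / 4 by field.
by rewrite D2; field.
Qed.

Lemma gain_ge0 G e : 0 <= G -> 0 <= e -> 0 <= gain G e.
Proof.
move=> G0 e0; rewrite /gain.
have : e - G * e <= Num.sqrt ((e - G * e) ^+ 2 + 4 * (G * e)).
  apply: le_trans (ler_norm _) _; rewrite -sqrtr_sqr ler_wsqrtr//.
  by rewrite lerDl !mulr_ge0.
by lra.
Qed.

Lemma gain_e0 G : gain G 0 = 0.
Proof. by rewrite /gain !(mulr0, subr0, addr0, expr0n)/= sqrtr0 mul0r. Qed.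

Lemma gain_G0 e : 0 <= e -> gain 0 e = 0.
Proof.
by move=> e0; rewrite /gain !(mul0r, mulr0, subr0, addr0) sqrtr_sqr ger0_norm// subrr mul0r.
Qed.

Lemma gain_gt0 G e : 0 < G -> 0 < e -> 0 < gain G e.
Proof.
move=> G0 e0; rewrite lt_def gain_ge0 ?ltW// andbT.
apply/eqP => g0; have := gain_eq (ltW G0) (ltW e0).
by rewrite g0 expr0n mulr0 addr0 => /esym/eqP; rewrite gt_eqF// mulr_gt0.
Qed.

(** The product of the two roots of the quadratic is - G e, which is negative, so only one root is
    nonnegative. *)
Lemma gain_unique G e y : 0 < G -> 0 < e -> 0 <= y ->
  y ^+ 2 + (e - G * e) * y = G * e -> gain G e = y.
Proof.
move=> G0 e0 y0 hy; have := gain_eq (ltW G0) (ltW e0).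
have := gain_gt0 G0 e0; set g := gain G e => g0 hg.
have : (y - g) * (y + g + (e - G * e)) = 0 by nra.
move/eqP; rewrite mulf_eq0 => /orP[/eqP|/eqP] h; first by lra.
have Ge : 0 < G * e by rewrite mulr_gt0.
have : y * g = - (G * e) by nra.
by have : 0 <= y * g by [rewrite mulr_ge0// ltW]; lra.
Qed.

(* [G + (G - 1) * gain G e] is the denominator in [gain_inv]. *)
Lemma gain_den_gt0 G e : 0 < G -> 0 <= e -> 0 < G + (G - 1) * gain G e.
Proof.
move=> G0 e0; have := gain_eq (ltW G0) e0; have := gain_ge0 (ltW G0) e0.
move: e0; rewrite le_eqVlt => /orP[/eqP<-|e0]; first by move=> _ _; rewrite gain_e0 mulr0 addr0.
have := gain_gt0 G0 e0; set g := gain G e => g0 _ hg.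
rewrite -(pmulr_rgt0 _ e0); have -> : e * (G + (G - 1) * g) = g ^+ 2 by nra.
exact: exprn_gt0.
Qed.

(** The equation of [gain_eq] is linear in e. This lets the correlation be eliminated in favour of
    the gain, both in the limit rate and in the equation for the optimal correlation. *)
Lemma gain_inv G e : 0 < G -> 0 <= e ->
  e = gain G e ^+ 2 / (G + (G - 1) * gain G e).
Proof.
move=> G0 e0; have M0 := gain_den_gt0 G0 e0; have := gain_eq (ltW G0) e0.
move=> h; have E : e * (G + (G - 1) * gain G e) = gain G e ^+ 2 by nra.
by rewrite -E mulfK// gt_eqF.
Qed.

Lemma gain_lt G e e' : 0 < G -> 0 <= e -> e < e' -> gain G e < gain G e'.
Proof.
move=> G0 e0 ee'; have e'0 : 0 < e' := le_lt_trans e0 ee'.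
have M0 := gain_den_gt0 G0 e0; have M'0 := gain_den_gt0 G0 (ltW e'0).
have g0 := gain_ge0 (ltW G0) e0; have g'0 := gain_gt0 G0 e'0.
have h := gain_eq (ltW G0) e0; have h' := gain_eq (ltW G0) (ltW e'0).
move: (gain G e) (gain G e') M0 M'0 g0 g'0 h h' => y y' M0 M'0 y0 y'0 h h'.
rewrite ltNge; apply/negP => yy.
have E : y ^+ 2 = e * (G + (G - 1) * y) by nra.
have E' : y' ^+ 2 = e' * (G + (G - 1) * y') by nra.
have : y ^+ 2 * (G + (G - 1) * y') < y' ^+ 2 * (G + (G - 1) * y).
  rewrite E E' -!mulrA [(G + (G - 1) * y') * _]mulrC.
  by rewrite ltr_pM2r// mulr_gt0.
(* Cross-multiplied comparison of the two values of e given by [gain_inv]; the difference has the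
   sign of y - y'. *)
have -> : y ^+ 2 * (G + (G - 1) * y') = y' ^+ 2 * (G + (G - 1) * y)
  + (y - y') * (y' * (G + (G - 1) * y) + G * y) by ring.
rewrite gtrDl; apply/negP; rewrite -leNgt mulr_ge0 ?subr_ge0// addr_ge0 ?mulr_ge0 ?ltW//.
exact: lt_le_trans yy.
Qed.

Lemma gain_e1 G : 0 <= G -> gain G 1 = G.
Proof.
move=> G0; rewrite /gain !mulr1.
have -> : (1 - G) ^+ 2 + 4 * G = (1 + G) ^+ 2 by ring.
by rewrite sqrtr_sqr ger0_norm ?addr_ge0//; field.
Qed.

Lemma gain_le G e : 0 <= G -> 0 <= e <= 1 -> gain G e <= G.
Proof.
rewrite le_eqVlt => /orP[/eqP<- /andP[? _]|G0]; first by rewrite gain_G0.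
move=> /andP[e0]; rewrite le_eqVlt => /orP[/eqP->|e1]; first by rewrite gain_e1// ltW.
by rewrite -[leRHS](gain_e1 (ltW G0)); apply/ltW/gain_lt.
Qed.

End prediction_gain.

Lemma innov_var_gain (R : realType) (v G a : R) : 0 < v ->
  0 <= G -> 0 <= a <= 1 ->
  innov_var v (G * v) a / v = 1 + gain G (1 - a ^+ 2).
Proof.
move=> v0 G0 /andP[a0 a1]; rewrite /innov_var /pred_var /gain.
have e0 : 0 <= 1 - a ^+ 2 by rewrite subr_ge0 expr_le1.
set e := 1 - a ^+ 2 in e0 *.
have -> : (v * e - G * v * e) ^+ 2 + 4 * v * (G * v * e) =
  v ^+ 2 * ((e - G * e) ^+ 2 + 4 * (G * e)) by ring.
rewrite sqrtrM ?sqr_ge0// sqrtr_sqr gtr0_norm//.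
by field; rewrite gt_eqF.
Qed.

Section exponent.
Context {R : realType}.
Implicit Types G y : R.

Definition exponent_of_gain G y := (ln (1 + y) - G * y / (G * (2 + y) - y)) / 2.

Definition slope G y := (G * (2 + y) - y) ^+ 2 - 2 * G ^+ 2 * (1 + y).

Lemma exponent_den_gt0 G y : 0 < G -> 0 <= y <= G -> 0 < G * (2 + y) - y.
Proof. by move=> G0 /andP[y0 y1]; nra. Qed.

Lemma is_derive_exponent G y : 0 < G -> 0 <= y <= G ->
  is_derive y 1 (exponent_of_gain G)
    (slope G y / (2 * (1 + y) * (G * (2 + y) - y) ^+ 2)).
Proof.
move=> G0 y01; have N0 := exponent_den_gt0 G0 y01.
have /andP[y0 _] := y01.
have y10 : 0 < 1 + y by rewrite ltr_pwDl.
have dl : is_derive (1 + y) 1 (@ln R) (1 + y)^-1 by exact: is_derive1_ln.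
have dd : is_derive y 1 ((cst 1 : R -> R) + id) (0 + 1) by exact: is_deriveD.
have dln := is_derive1_comp dl dd.
have dN : is_derive y 1 (G *: ((cst 2 : R -> R) + id) - id) (G *: (0 + 1) - 1).
  exact: is_deriveB.
have N0' : (G *: ((cst 2 : R -> R) + id) - id) y != 0 by exact: lt0r_neq0.
have dV := is_deriveV N0' dN.
have dG : is_derive y 1 (G *: (id : R -> R)) (G *: 1) by exact: is_deriveZ.
have dM := is_deriveM dG dV.
have dB := is_deriveB dln dM.
have dZ := is_deriveZ 2^-1 dB.
have -> : exponent_of_gain G = 2^-1 *: ((ln (R:=R)) \o ((cst 1 : R -> R) + id) -
   (G *: (id : R -> R)) * (fun y => ((G *: ((cst 2 : R -> R) + id) - id) y)^-1)).
  by apply/funext => x; rewrite /exponent_of_gain mulrC.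
apply: is_derive_eq.
have -> : (G *: ((cst 2 : R -> R) + id) - id) y = G * (2 + y) - y by [].
rewrite /slope /GRing.scale/= /GRing.scale/=.
by field; rewrite !gt_eqF.
Qed.

(* [y = 2 G / (2 - G + sqrt (2 - G ^ 2))] is the root of the quadratic
   [slope G] in [0, G], written so that it is regular at [G = 1]. *)
Definition best_gain G := 2 * G / (2 - G + Num.sqrt (2 - G ^+ 2)).

Lemma slope_gt0 G y : 1 <= G -> 0 <= y < G -> 0 < slope G y.
Proof.
move=> G1 /andP[y0 yG].
(* With M = G + (G - 1) y at least G, the right-hand side is at least 2 G (G - y). *)
have -> : slope G y = (G + (G - 1) * y) ^+ 2 + G ^+ 2 - 2 * G * y.
  by rewrite /slope; ring.
have : G <= G + (G - 1) * y by nra.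
move: (G + _) => M GM; nra.
Qed.

Lemma best_gain_bounds G : 0 < G < 1 ->
  [/\ 1 < Num.sqrt (2 - G ^+ 2), 0 < best_gain G & best_gain G < G].
Proof.
move=> /andP[G0 G1].
have s1 : 1 < Num.sqrt (2 - G ^+ 2).
  by rewrite -[ltLHS]sqrtr1 ltr_sqrt; nra.
have q0 : 0 < 2 - G + Num.sqrt (2 - G ^+ 2) by lra.
split=> //; first by rewrite divr_gt0 ?mulr_gt0.
by rewrite /best_gain ltr_pdivrMr// mulrC ltr_pM2l//; lra.
Qed.

(** The cofactor vanishes at the larger root of the quadratic, G (2 - G + s) / (1 - G)^2 with s the
    square root of 2 - G^2; that root lies beyond G, so the cofactor is positive on [0, G]. *)
Lemma slope_best_gain G y : 0 < G < 1 ->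
  slope G y = (best_gain G - y) *
    (G * (2 - G + Num.sqrt (2 - G ^+ 2)) - (1 - G) ^+ 2 * y).
Proof.
move=> G01; have [s1 _ _] := best_gain_bounds G01; move/andP: G01 => [G0 G1].
rewrite /slope /best_gain.
have : Num.sqrt (2 - G ^+ 2) ^+ 2 = 2 - G ^+ 2 by rewrite sqr_sqrtr//; nra.
move: (Num.sqrt _) s1 => s s1 s2.
have q0 : 2 - G + s != 0 by rewrite gt_eqF//; lra.
transitivity ((2 * G / (2 - G + s) - y) * (G * (2 - G + s) - (1 - G) ^+ 2 * y) +
    G * y / (2 - G + s) * (s ^+ 2 - (2 - G ^+ 2))); last by rewrite s2 subrr mulr0 addr0.
by field.
Qed.

Lemma slope_sign G y : 0 < G < 1 -> 0 <= y <= G ->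
  (0 < slope G y) = (y < best_gain G) /\ (slope G y < 0) = (best_gain G < y).
Proof.
move=> G01 /andP[y0 yG]; have [s1 _ _] := best_gain_bounds G01.
rewrite slope_best_gain//; move/andP: G01 => [G0 G1].
have h : 0 < G * (2 - G + Num.sqrt (2 - G ^+ 2)) - (1 - G) ^+ 2 * y.
  by move: (Num.sqrt _) s1 => s s1; nra.
by rewrite pmulr_lgt0// pmulr_llt0// subr_gt0 subr_lt0.
Qed.

Lemma exponent_of_gain_cts G y z : 0 < G -> 0 <= y -> z <= G ->
  {within `[y, z], continuous (exponent_of_gain G)}.
Proof.
move=> G0 y0 zG; apply: derivable_within_continuous => x.
rewrite in_itv/= => /andP[yx xz].
have x01 : 0 <= x <= G by rewrite (le_trans y0 yx) (le_trans xz zG).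
by apply: ex_derive; exact: is_derive_exponent.
Qed.

(** The sign is asked on the open interval only, because the slope may vanish at u: it does at u =
    [best_gain G], and at u = G when G = 1. *)
Lemma exponent_of_gain_lt G l u : 0 < G -> 0 <= l -> u <= G ->
  (forall x, l < x < u -> 0 < slope G x) ->
  forall y z, l <= y -> y < z -> z <= u -> exponent_of_gain G y < exponent_of_gain G z.
Proof.
move=> G0 l0 uG hs y z ly yz zu.
apply: (@gtr0_derive1_lt_cc _ _ l u) => //; first last.
- by rewrite in_itv/= (le_trans ly (ltW yz)).
- by rewrite in_itv/= ly (le_trans (ltW yz)).
- exact: exponent_of_gain_cts.
- move=> x; rewrite in_itv/= => /andP[lx xu].
  have x01 : 0 <= x <= G by rewrite (le_trans l0 (ltW lx)) (le_trans (ltW xu) uG).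
  have dx := is_derive_exponent G0 x01.
  rewrite derive1E (@derive_val _ _ _ _ _ _ _ dx) divr_gt0//; first by rewrite hs// lx.
  have /andP[x0 _] := x01.
  by rewrite !mulr_gt0 ?exprn_gt0 ?exponent_den_gt0// ltr_pwDl.
- move=> x; rewrite in_itv/= => /andP[lx xu].
  apply: ex_derive; apply: is_derive_exponent => //.
  by rewrite (le_trans l0 (ltW lx)) (le_trans (ltW xu) uG).
Qed.

Lemma exponent_of_gain_gt G l u : 0 < G -> 0 <= l -> u <= G ->
  (forall x, l < x < u -> slope G x < 0) ->
  forall y z, l <= y -> y < z -> z <= u -> exponent_of_gain G z < exponent_of_gain G y.
Proof.
move=> G0 l0 uG hs y z ly yz zu.
apply: (@ltr0_derive1_lt_cc _ _ l u) => //; first last.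
- by rewrite in_itv/= ly (le_trans (ltW yz)).
- by rewrite in_itv/= (le_trans ly (ltW yz)).
- exact: exponent_of_gain_cts.
- move=> x; rewrite in_itv/= => /andP[lx xu].
  have x01 : 0 <= x <= G by rewrite (le_trans l0 (ltW lx)) (le_trans (ltW xu) uG).
  have dx := is_derive_exponent G0 x01.
  rewrite derive1E (@derive_val _ _ _ _ _ _ _ dx) pmulr_llt0; first by rewrite hs// lx.
  have /andP[x0 _] := x01.
  by rewrite invr_gt0 !mulr_gt0 ?exprn_gt0 ?exponent_den_gt0// ltr_pwDl.
- move=> x; rewrite in_itv/= => /andP[lx xu].
  apply: ex_derive; apply: is_derive_exponent => //.
  by rewrite (le_trans l0 (ltW lx)) (le_trans (ltW xu) uG).
Qed.

Lemma exponent_best_gain G y : 0 < G < 1 -> 0 <= y <= G -> y != best_gain G ->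
  exponent_of_gain G y < exponent_of_gain G (best_gain G).
Proof.
move=> G01 /andP[y0 yG]; have [_ b0 bG] := best_gain_bounds G01.
have /andP[G0 _] := G01.
rewrite neq_lt => /orP[yb|yb].
- apply: (@exponent_of_gain_lt G 0 (best_gain G)) => //; first exact: ltW.
  move=> x /andP[x0 xb]; have [|-> _] := @slope_sign G x G01 => //.
  by rewrite (ltW x0)/=; lra.
- apply: (@exponent_of_gain_gt G (best_gain G) G) => //; first exact: ltW.
  move=> x /andP[bx xG]; have [|_ ->] := @slope_sign G x G01 => //.
  by rewrite (ltW xG) andbT; lra.
Qed.

(** Substituting a^2 from [gain_inv] turns the left-hand side into (y / (G + (G - 1) y))^2 times the
    slope. The factor is nonzero only for a < 1: at a = 1 the equation holds for every SNR, as 2^2 -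
    2 (1 + 1) = 0. *)
Lemma astar_equation_slope v G a : 0 < v -> 0 < G -> 0 <= a < 1 ->
  astar_equation v G a <-> slope G (gain G (1 - a ^+ 2)) = 0.
Proof.
move=> v0 G0 /andP[a0 a1].
have e0 : 0 < 1 - a ^+ 2 by rewrite subr_gt0 expr_lt1.
have a01 : 0 <= a <= 1 by rewrite a0 ltW.
rewrite /astar_equation (innov_var_gain v0 (ltW G0) a01).
have M0 := gain_den_gt0 G0 (ltW e0).
have y0 := gain_gt0 G0 e0.
have h := gain_inv G0 (ltW e0).
set y := gain G (1 - a ^+ 2) in M0 y0 h *.
have -> : a ^+ 4 = (a ^+ 2) ^+ 2 by ring.
have -> : a ^+ 2 = 1 - y ^+ 2 / (G + (G - 1) * y) by rewrite -h; ring.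
have -> : (1 + (1 - y ^+ 2 / (G + (G - 1) * y)) +
    G * (1 - (1 - y ^+ 2 / (G + (G - 1) * y)))) ^+ 2 -
  2 * (1 + y + (1 - y ^+ 2 / (G + (G - 1) * y)) ^+ 2 / (1 + y)) =
  (y / (G + (G - 1) * y)) ^+ 2 * slope G y.
  by rewrite /slope; field; rewrite !gt_eqF//; lra.
have : (y / (G + (G - 1) * y)) ^+ 2 != 0 by rewrite expf_neq0// gt_eqF// divr_gt0.
move=> {}h; split=> [/eqP|->]; last by rewrite mulr0.
by rewrite mulf_eq0 (negbTE h) => /eqP.
Qed.

End exponent.

(** The precision supplied is y / Q, so 1 + pbar Q = 1 + y is the normalised innovation variance.
    The rate is twice the exponent because it is that of twice the log-likelihood ratio. *)
Lemma lim_rate_gain (R : realType) (v G a : R) : 0 < v -> 0 < G -> 0 < 1 - a ^+ 2 ->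
  lim_rate v (G * v) a (gain G (1 - a ^+ 2) / (G * v * (1 - a ^+ 2))) =
  2 * exponent_of_gain G (gain G (1 - a ^+ 2)).
Proof.
move=> v0 G0 e0; have y0 := gain_gt0 G0 e0.
have M0 := gain_den_gt0 G0 (ltW e0); have h := gain_inv G0 (ltW e0).
have Q0 : 0 < G * v * (1 - a ^+ 2) by rewrite !mulr_gt0.
rewrite /lim_rate /lim_coef /exponent_of_gain divfK ?gt_eqF//.
set y := gain _ _ in y0 M0 h *.
rewrite [RHS]mulrC divfK//; congr (_ - _).
have -> : (a / (1 + y)) ^+ 2 = (1 - (1 - a ^+ 2)) / (1 + y) ^+ 2.
  by rewrite expr_div_n; congr (_ / _); ring.
rewrite h; clearbody y; clear h Q0 e0.
have N0 : 0 < G * (2 + y) - y by nra.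
have D0 : (1 + y) ^+ 2 - (1 - y ^+ 2 / (G + (G - 1) * y)) =
    y * (1 + y) * (G * (2 + y) - y) / (G + (G - 1) * y).
  by field; rewrite gt_eqF.
have y10 : 0 < 1 + y by lra.
have -> : 1 - (1 - y ^+ 2 / (G + (G - 1) * y)) / (1 + y) ^+ 2 =
   y * (G * (2 + y) - y) / (G + (G - 1) * y) / (1 + y).
  by field; rewrite !gt_eqF.
by field; rewrite !gt_eqF.
Qed.

Lemma error_exponent_gain (R : realType) (v G a alpha : R) (S : gm_system R) :
  0 < v -> 0 <= G -> 0 <= a <= 1 -> 0 < alpha < 1 ->
  gm_model v (G * v) a S ->
  error_exponent a S alpha = exponent_of_gain G (gain G (1 - a ^+ 2)).
Proof.
move=> v0 G0 a01 alpha01 hS.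
have Pi00 : 0 <= G * v by rewrite mulr_ge0// ltW.
have /andP[a0 a1] := a01.
have e0 : 0 <= 1 - a ^+ 2 by rewrite subr_ge0 expr_le1.
apply: (error_exponent_stein v0 Pi00 a01 hS) => // eps eps0.
have [Q0|Q0] := eqVneq (G * v * (1 - a ^+ 2)) 0.
  have -> : exponent_of_gain G (gain G (1 - a ^+ 2)) = 0.
    have -> : gain G (1 - a ^+ 2) = 0.
      move/eqP: Q0; rewrite !mulf_eq0 (gt_eqF v0) orbF => /orP[/eqP->|/eqP->].
        by rewrite gain_G0.
      by rewrite gain_e0.
    by rewrite /exponent_of_gain addr0 ln1 mulr0 !mul0r subr0 mul0r.
  have [C hC] := log_lr_deviation0 v0 Pi00 a01 hS Q0 eps0.
  exists C => n n0; under eq_integral do rewrite mulr0 mul0r addr0.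
  exact: hC.
move: Q0; rewrite !mulf_eq0 !negb_or => /andP[/andP[G1 _] e1].
have {}G0 : 0 < G by rewrite lt_def G1.
have {}e0 : 0 < 1 - a ^+ 2 by rewrite lt_def e1.
have a1' : a < 1.
  by rewrite lt_neqAle a1 andbT; apply: contra e1 => /eqP->; rewrite expr1n subrr.
have Q0 : 0 < G * v * (1 - a ^+ 2) by rewrite !mulr_gt0.
have y0 := gain_gt0 G0 e0.
pose pbar := gain G (1 - a ^+ 2) / (G * v * (1 - a ^+ 2)).
have pbar0 : 0 <= pbar by rewrite divr_ge0 ?ltW.
(* Cleared of denominators, the stationary Riccati equation is the quadratic equation of the
   gain. *)
have pbarE : pbar = v^-1 + a ^+ 2 * (pbar / (1 + pbar * (G * v * (1 - a ^+ 2)))).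
  rewrite /pbar divfK ?gt_eqF//.
  have := gain_eq (ltW G0) (ltW e0).
  have -> : a ^+ 2 = 1 - (1 - a ^+ 2) by ring.
  rewrite [1 - (1 - (1 - _))](_ : _ = 1 - a ^+ 2); last by ring.
  move: (1 - a ^+ 2) (gain G _) e0 y0 => e y e0 y0 hy.
  have y1 : 0 < 1 + y by rewrite ltr_pwDl// ltW.
  apply/eqP; rewrite -subr_eq0.
  have -> : y / (G * v * e) - (v^-1 + (1 - e) * (y / (G * v * e) / (1 + y))) =
    (y ^+ 2 + (e - G * e) * y - G * e) / (G * v * e * (1 + y)).
    by field; rewrite !gt_eqF.
  by rewrite hy subrr mul0r.
have [C hC] := log_lr_deviation_stationary v0 Pi00 a01 hS pbarE pbar0 a1' eps0.
exists C => n n0; have := hC n n0; rewrite /pbar (lim_rate_gain v0 G0 e0).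
by [].
Qed.

(** * Continuity and the optimal correlation *)

Section main.
Context {R : realType}.
Implicit Types G a : R.

Lemma continuous_gain G : continuous (fun a => gain G (1 - a ^+ 2)).
Proof.
move=> a; rewrite /gain.
have ce : {for a, continuous (fun a : R => 1 - a ^+ 2)}.
  apply: cvgB; first exact: cvg_cst.
  exact: exprn_continuous.
have cG : {for a, continuous (fun a : R => G * (1 - a ^+ 2))}.
  by apply: cvgM => //; exact: cvg_cst.
apply: cvgM; last exact: cvg_cst.
apply: cvgD => //; apply: cvgB => //.
apply: (@continuous_comp _ _ _ (fun a : R =>
  (1 - a ^+ 2 - G * (1 - a ^+ 2)) ^+ 2 + 4 * (G * (1 - a ^+ 2))) Num.sqrt);
  last exact: sqrt_continuous.
apply: cvgD.
  apply: (@continuous_comp _ _ _ (fun a : R => 1 - a ^+ 2 - G * (1 - a ^+ 2))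
    (fun x => x ^+ 2)).
    by apply: cvgB.
  exact: exprn_continuous.
by apply: cvgM => //; exact: cvg_cst.
Qed.

Lemma continuous_exponent G : 0 < G ->
  {within `[0, 1], continuous (fun a => exponent_of_gain G (gain G (1 - a ^+ 2)))}.
Proof.
move=> G0; apply: continuous_in_subspaceT => a; rewrite inE/= in_itv/= => /andP[a0 a1].
have e01 : 0 <= 1 - a ^+ 2 <= 1 by rewrite subr_ge0 expr_le1// a1 gerBl sqr_ge0.
have /andP[e0 e1] := e01.
apply: (@continuous_comp _ _ _ (fun a => gain G (1 - a ^+ 2)) (exponent_of_gain G)).
  exact: continuous_gain.
apply: differentiable_continuous; apply/derivable1_diffP; apply: ex_derive.
by apply: is_derive_exponent; rewrite ?gain_ge0 ?gain_le// ltW.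
Qed.

(** The correlation whose gain is [best_gain G]: [gain_inv] solved for a. *)
Definition best_corr G :=
  Num.sqrt (1 - best_gain G ^+ 2 / (G + (G - 1) * best_gain G)).

Lemma best_corr_spec G : 0 < G < 1 ->
  [/\ 0 < best_corr G, best_corr G < 1 &
      gain G (1 - best_corr G ^+ 2) = best_gain G].
Proof.
move=> G01; have [_ y0 yG] := best_gain_bounds G01; have /andP[G0 G1] := G01.
rewrite /best_corr; move: (best_gain G) y0 yG => y y0 yG.
have M0 : 0 < G + (G - 1) * y by nra.
have e0 : 0 < y ^+ 2 / (G + (G - 1) * y) by rewrite divr_gt0// exprn_gt0.
(* Amounts to (y - G) (y + 1) < 0. *)
have e1 : y ^+ 2 / (G + (G - 1) * y) < 1.
  by rewrite ltr_pdivrMr// mul1r; nra.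
rewrite sqr_sqrtr ?subr_ge0 ?ltW// subKr; split.
- by rewrite sqrtr_gt0 subr_gt0.
- by rewrite -[ltRHS]sqrtr1 ltr_sqrt// gtrBl.
- apply: gain_unique => //; first exact: ltW.
  by field; rewrite gt_eqF.
Qed.

Lemma gain_corr_inj G a b : 0 < G -> 0 <= a <= 1 -> 0 <= b <= 1 ->
  gain G (1 - a ^+ 2) = gain G (1 - b ^+ 2) -> a = b.
Proof.
move=> G0 /andP[a0 a1] /andP[b0 b1] h.
have ea : 0 <= 1 - a ^+ 2 by rewrite subr_ge0 expr_le1.
have eb : 0 <= 1 - b ^+ 2 by rewrite subr_ge0 expr_le1.
have : a ^+ 2 == b ^+ 2.
  have := gain_inv G0 ea; rewrite h -(gain_inv G0 eb) => E.
  by apply/eqP; lra.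
by rewrite eqrXn2// => /eqP.
Qed.

Lemma best_corr_max G b : 0 < G < 1 -> 0 <= b <= 1 -> b != best_corr G ->
  exponent_of_gain G (gain G (1 - b ^+ 2)) <
  exponent_of_gain G (gain G (1 - best_corr G ^+ 2)).
Proof.
move=> G01 b01 bb; have [c0 c1 cE] := best_corr_spec G01; have /andP[G0 _] := G01.
have /andP[b0 b1] := b01.
have e0 : 0 <= 1 - b ^+ 2 by rewrite subr_ge0 expr_le1.
rewrite cE; apply: exponent_best_gain => //.
  by rewrite gain_ge0 ?gain_le ?e0 ?gerBl ?sqr_ge0// ltW.
apply: contra bb; rewrite -cE => /eqP h; apply/eqP.
by apply: (gain_corr_inj G0 b01 _ h); rewrite !ltW.
Qed.

Lemma best_corr_cvg G : 0 < G -> G <= 2^-1 -> `|1 - best_corr G| <= 4 * G.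
Proof.
move=> G0 G2; have G01 : 0 < G < 1 by rewrite G0; lra.
have [s1 y0 yG] := best_gain_bounds G01; have [c0 c1 _] := best_corr_spec G01.
rewrite gtr0_norm ?subr_gt0//.
(* As G <= 1/2 and the square root exceeds 1, the denominator of [best_gain] is at least 5/2. Hence
   G + (G - 1) y >= G - y >= G / 5, and 1 - a^2 is at most 16 G / 5. *)
have y8 : best_gain G <= 4 / 5 * G.
  rewrite /best_gain ler_pdivrMr; last by lra.
  move: (Num.sqrt _) s1 => s s1; nra.
have : 1 - best_corr G ^+ 2 <= 4 * G.
  rewrite /best_corr; move: (best_gain G) y0 yG y8 => y y0 yG y8.
  have M0 : G / 5 <= G + (G - 1) * y by nra.
  have M00 : 0 < G + (G - 1) * y by lra.
  have e1 : y ^+ 2 / (G + (G - 1) * y) <= 4 * G.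
    rewrite ler_pdivrMr//; apply: (@le_trans _ _ (4 * G * (G / 5))).
      by nra.
    by rewrite ler_pM2l ?mulr_gt0.
  rewrite sqr_sqrtr; first by lra.
  rewrite subr_ge0 ler_pdivrMr// mul1r; nra.
by nra.
Qed.

End main.

Theorem theorem2 (R : realType) (sigma2 alpha : R)
    (S : R -> R -> gm_system R)
    (hsigma2 : 0 < sigma2) (halpha : 0 < alpha < 1)
    (hS : forall Gamma a : R, 0 <= Gamma -> 0 <= a <= 1 ->
       gm_model sigma2 (Gamma * sigma2) a (S Gamma a)) :
  let K := fun Gamma a : R => error_exponent a (S Gamma a) alpha in
  [/\ (forall Gamma : R, 0 <= Gamma ->
         {within `[0, 1], continuous (K Gamma)}),
      (forall Gamma : R, 1 <= Gamma ->
         forall a b : R, 0 <= a -> a < b -> b <= 1 -> K Gamma b < K Gamma a),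
      (forall Gamma : R, 0 <= Gamma < 1 ->
         exists astar : R,
           [/\ astar != 0,
               maximizes (K Gamma) astar,
               astar_equation sigma2 Gamma astar &
               forall b : R, 0 <= b < 1 ->
                 astar_equation sigma2 Gamma b -> b = astar]) &
      (forall astar : R -> R,
         (forall Gamma : R, 0 < Gamma < 1 ->
            maximizes (K Gamma) (astar Gamma)) ->
         astar Gamma @[Gamma --> 0^'+] --> (1 : R))].
Proof.
move=> K.
have KE G a : 0 <= G -> 0 <= a <= 1 ->
    K G a = exponent_of_gain G (gain G (1 - a ^+ 2)).
  by move=> G0 a01; apply: error_exponent_gain (hS G a G0 a01).
have K0 a : 0 <= a <= 1 -> K 0 a = 0.
  move=> a01; rewrite KE// gain_G0; last by case/andP: a01 => a0 a1; rewrite subr_ge0 expr_le1.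
  by rewrite /exponent_of_gain addr0 ln1 !mul0r subr0 mul0r.
split.
- move=> G; rewrite le_eqVlt => /orP[/eqP<-|G0].
    (* At SNR 0 the fraction in [exponent_of_gain] has denominator 0 at gain 0, so continuity is
       read off the constant value 0. *)
    apply: (@subspace_eq_continuous _ _ _ (fun=> 0)).
      by move=> a; rewrite inE/= in_itv/= => a01; rewrite /from_subspace K0.
    by apply: continuous_subspaceT => ?; exact: cvg_cst.
  apply: (@subspace_eq_continuous R `[0, 1] R (fun a : R =>
    exponent_of_gain G (gain G (1 - a ^+ 2)) : R)).
    by move=> a; rewrite inE/= in_itv/= => a01; rewrite /from_subspace KE// ltW.
  exact: continuous_exponent.
- move=> G G1 a b a0 ab b1.
  have G0 : 0 < G := lt_le_trans ltr01 G1.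
  have b0 : 0 <= b := le_trans a0 (ltW ab).
  have a1 : a <= 1 := le_trans (ltW ab) b1.
  rewrite !KE ?a0 ?b0 ?(ltW G0)//.
  have ea : 0 <= 1 - a ^+ 2 <= 1 by rewrite subr_ge0 expr_le1// a1 gerBl sqr_ge0.
  have eb : 0 <= 1 - b ^+ 2 by rewrite subr_ge0 expr_le1.
  apply: (@exponent_of_gain_lt _ G 0 G) => //.
  + by move=> x /andP[x0 xG]; apply: slope_gt0 => //; rewrite (ltW x0).
  + by rewrite gain_ge0// ltW.
  + by apply: gain_lt => //; rewrite ltrD2l ltrN2 ltr_pXn2r.
  + by rewrite gain_le// ltW.
- move=> G /andP[]; rewrite le_eqVlt => /orP[/eqP<- _|G0 G1].
    (* At SNR 0 every correlation maximizes K, which is identically 0; the equation becomes - (1 -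
       a^2)^2 = 0 and singles out 1. *)
    exists 1; split.
    + exact: oner_neq0.
    + by split; [rewrite ler01 lexx|move=> b b01; rewrite !K0// ler01 lexx].
    + rewrite /astar_equation (innov_var_gain hsigma2)//; last by rewrite ler01 lexx.
      by rewrite expr1n subrr gain_e0 addr0 expr1n invr1; ring.
    + move=> b /andP[b0 b1]; rewrite /astar_equation (innov_var_gain hsigma2)//;
        last by rewrite b0 ltW.
      have e0 : 0 < 1 - b ^+ 2 by rewrite subr_gt0 expr_lt1.
      rewrite gain_G0 ?ltW// addr0 divr1 mul0r addr0 => h.
      have : (1 - b ^+ 2) ^+ 2 = 0 by lra.
      by move/eqP; rewrite sqrf_eq0 gt_eqF.
  have G01 : 0 < G < 1 by rewrite G0.
  have [c0 c1 cE] := best_corr_spec G01.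
  have c01 : 0 <= best_corr G <= 1 by rewrite !ltW.
  exists (best_corr G); split.
  + by rewrite gt_eqF.
  + split=> // b b01; rewrite !KE ?(ltW G0)//.
    by have [->//|bc] := eqVneq b (best_corr G); exact/ltW/best_corr_max.
  + apply/(astar_equation_slope hsigma2 G0); first by rewrite (ltW c0).
    by rewrite cE slope_best_gain// subrr mul0r.
  + move=> b /andP[b0 b1] /(astar_equation_slope hsigma2 G0).
    rewrite b0 b1 => /(_ isT) h.
    have b01 : 0 <= b <= 1 by rewrite b0 ltW.
    have e0 : 0 <= 1 - b ^+ 2 by rewrite subr_ge0 expr_le1// ltW.
    apply: (gain_corr_inj G0 b01 c01); rewrite cE.
    have yG : 0 <= gain G (1 - b ^+ 2) <= G.
      by rewrite gain_ge0 ?gain_le ?e0 ?gerBl ?sqr_ge0// ltW.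
    (* A zero slope makes both strict comparisons with [best_gain G] false, so the gains agree. *)
    have [] := slope_sign G01 yG; rewrite h ltxx => /esym/negbT + /esym/negbT.
    rewrite -!leNgt => h1 h2; apply/eqP; by rewrite eq_le h1 h2.
- move=> astar hmax; apply/cvgrPdist_le => e e0.
  near=> G.
  have G0 : 0 < G by near: G; exact: nbhs_right_gt.
  have G2 : G <= 2^-1 by near: G; apply: nbhs_right_le; rewrite invr_gt0.
  have Ge : G <= e / 4 by near: G; apply: nbhs_right_le; rewrite divr_gt0.
  have G01 : 0 < G < 1 by rewrite G0; lra.
  have [c0 c1 cE] := best_corr_spec G01.
  have c01 : 0 <= best_corr G <= 1 by rewrite !ltW.
  have [b01 bmax] := hmax G G01.
  (* The maximum is strict, so any choice of maximizers is forced for G in (0, 1). *)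
  have -> : astar G = best_corr G.
    apply/eqP; apply: contraT => bc.
    have := bmax _ c01; rewrite !KE ?(ltW G0)// leNgt best_corr_max//.
  by apply: (le_trans (best_corr_cvg G0 G2)); lra.
Unshelve. all: by end_near.
Qed.
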